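(* Let $G=(V,E)$ be a finite simple graph with an automorphism $\theta$, $\theta^2=\mathrm{id}$, and let $\tau$ send the generator of $\mathbb{Z}_2$ to $-I$ (inversion in the origin). Then $G$ is $C_i$-isostatic on $\mathcal{Y}$ (i.e. there exists a framework $(G,p)$ on $\mathcal{Y}$ with $p(\theta(v))=-p(v)$ for all $v$ which is isostatic) if and only if $G$ is $(2,2)$-tight and $\theta$ fixes no vertex and no edge.
   Context: $\mathcal{Y}=\{(x,y,z):x^2+y^2=1\}$. A framework on $\mathcal{Y}$ is $(G,p)$ with $p:V\to\mathcal{Y}$, $p(u)\ne p(v)$ for edges $uv$. Its rigidity matrix is the $(|E|+|V|)\times3|V|$ matrix with a row for each edge $v_iv_j$ having $p(v_i)-p(v_j)$ in the columns of $v_i$ and $p(v_j)-p(v_i)$ in those of $v_j$, and a row for each vertex $v_i$, $p(v_i)=(x_i,y_i,z_i)$, having $(x_i,y_i,0)$ in its columns (zeros elsewhere). Isostatic means the rows are linearly independent and every kernel vector has the form $u_i=(0,0,a)+b(-y_i,x_i,0)$. A vertex is fixed by $\theta$ if $\theta(v)=v$; an edge $uv$ is fixed if $\{\theta(u),\theta(v)\}=\{u,v\}$. $G$ is $(2,2)$-tight if $|E|=2|V|-2$ and every subgraph $(V',E')$ with $V'\neq\emptyset$ has $|E'|\le2|V'|-2$. *)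

(* Defs.v *)
From HB Require Import structures.
From mathcomp Require Import all_boot all_order all_algebra.
From mathcomp Require Import reals.
Set Implicit Arguments. Unset Strict Implicit. Unset Printing Implicit Defensive.
Import Order.TTheory GRing.Theory Num.Theory.
Local Open Scope ring_scope.

(* A finite simple graph on the finType V is a symmetric irreflexive relation
   e : rel V.  Its edges are represented (each exactly once) by the ordered
   pairs (u,v) with e u v and enum_rank u < enum_rank v. *)
Definition edge_pred (V : finType) (e : rel V) (uv : V * V) : bool :=
  e uv.1 uv.2 && (enum_rank uv.1 < enum_rank uv.2)%N.

Definition edge_of (V : finType) (e : rel V) := {uv : V * V | edge_pred e uv}.

Definition vec3 (R : nzRingType) (x y z : R) : 'rV[R]_3 :=
  \row_(k < 3) nth 0 [:: x; y; z] k.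

Definition on_cylinder (R : nzRingType) (q : 'rV[R]_3) : Prop :=
  q 0 0 ^+ 2 + q 0 1 ^+ 2 = 1.

Definition framework_on_Y (R : nzRingType) (V : finType) (e : rel V)
  (p : V -> 'rV[R]_3) : Prop :=
  (forall v, on_cylinder (p v)) /\ (forall u v, e u v -> p u != p v).

Definition rig_entry (R : nzRingType) (V : finType) (e : rel V)
  (p : V -> 'rV[R]_3) (r : (edge_of e + V)%type) (c : (V * 'I_3)%type) : R :=
  match r with
  | inl f => let u := (val f).1 in let v := (val f).2 in
      if c.1 == u then (p u - p v) 0 c.2
      else if c.1 == v then (p v - p u) 0 c.2 else 0
  | inr v => if c.1 == v then vec3 (p v 0 0) (p v 0 1) 0 0 c.2 else 0
  end.

Definition rigidity_matrix (R : nzRingType) (V : finType) (e : rel V)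
  (p : V -> 'rV[R]_3) :
  'M[R]_(#|{: (edge_of e + V)%type}|, #|{: (V * 'I_3)%type}|) :=
  \matrix_(i, j) @rig_entry R V e p (enum_val i) (enum_val j).

Definition isostatic (R : fieldType) (V : finType) (e : rel V)
  (p : V -> 'rV[R]_3) : Prop :=
  row_free (@rigidity_matrix R V e p) /\
  forall u : 'cV[R]_(#|{: (V * 'I_3)%type}|),
    @rigidity_matrix R V e p *m u = 0 ->
    exists a b : R, forall (w : V) (k : 'I_3),
      u (enum_rank (w, k)) 0 = vec3 (- b * p w 0 1) (b * p w 0 0) a 0 k.

Definition tight22 (V : finType) (e : rel V) : Prop :=
  (#|{: edge_of e}| + 2 = 2 * #|V|)%N /\
  forall (V' : {set V}) (E' : {set edge_of e}),
    V' != set0 ->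
    (forall f, f \in E' -> ((val f).1 \in V') && ((val f).2 \in V')) ->
    (#|E'| + 2 <= 2 * #|V'|)%N.

Definition Ci_isostatic (R : realType) (V : finType) (e : rel V)
  (theta : V -> V) : Prop :=
  exists p : V -> 'rV[R]_3,
    @framework_on_Y R V e p /\ (forall v, p (theta v) = - p v) /\ @isostatic R V e p.

Definition fixes_vertex (V : finType) (theta : V -> V) : Prop :=
  exists v, theta v = v.

Definition fixes_edge (V : finType) (e : rel V) (theta : V -> V) : Prop :=
  exists u v, e u v /\
    ((theta u = u /\ theta v = v) \/ (theta u = v /\ theta v = u)).

(* Main.v *)
Require Import Defs.
From HB Require Import structures.
From mathcomp Require Import all_boot all_order all_algebra.
From mathcomp Require Import reals boolp.
From mathcomp Require Import ring lra zify.
Set Implicit Arguments. Unset Strict Implicit. Unset Printing Implicit Defensive.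
Import Order.TTheory GRing.Theory Num.Theory.
Local Open Scope ring_scope.

(* In cylindrical coordinates a tangential velocity at [v] is a pair [(w, om)]
   (axial and angular), and the equation of an edge [uv] reads
     [(z_u - z_v) (w_u - w_v) + det (P_v, P_u) (om_u - om_v) = 0],
   with [P] the projection to the unit circle.

   Necessity.  The count is the rank count of the rigidity matrix.  A fixed edge
   is excluded by a trace: theta acts by permutations on rows and columns and
   changes the sign of the matrix, so the number of fixed rows equals minus the
   number of fixed columns plus the trace on the two trivial motions, [1 - 1].

   Sufficiency.  Velocities split into invariant and anti-invariant ones, each a
   system on the gain graph of the vertex orbits.  That each system has only
   trivial solutions for some position is proved by induction on the number of
   orbits, for a wider class of graphs having besides the given edges "free"
   multi-edges with arbitrary coefficients.  Some orbit has degree at most 3.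
   In degree 3, delete it and add a free edge between two of its neighbours not
   in a common tight set: as the new edge may be parallel to an old one, complete
   graphs on four vertices are no obstruction.  Dropping the free edge again
   leaves one flex which is not constant on the three neighbours, and if every
   position of the deleted vertex allowed an extension of this flex, three
   distinct points of a circle would be affinely dependent.  Positions for the
   two systems are combined along a line in the parameter space, on which
   each condition holds outside the zeros of a nonzero polynomial. *)

(** * Generic conditions along a line *)

Section Cofinite.
Variable R : realFieldType.
Implicit Type C : R -> Prop.

(** Stable under finite conjunction, by products, and satisfiable, since a nonzero polynomial has
    finitely many roots. *)
Definition cofin C := exists2 f : {poly R}, f != 0 & forall s, f.[s] != 0 -> C s.

Lemma cofin_mono C1 C2 : (forall s, C1 s -> C2 s) -> cofin C1 -> cofin C2.
Proof. by move=> C12 [f f0 fC]; exists f => // s /fC /C12. Qed.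

Lemma cofin_and C1 C2 : cofin C1 -> cofin C2 -> cofin (fun s => C1 s /\ C2 s).
Proof.
move=> [f f0 fC] [h h0 hC]; exists (f * h); first by rewrite mulf_neq0.
by move=> s; rewrite hornerM mulf_eq0 negb_or => /andP[/fC ? /hC].
Qed.

Lemma cofin_all (I : finType) (C : I -> R -> Prop) :
  (forall i, cofin (C i)) -> cofin (fun s => forall i, C i s).
Proof.
move=> /(_ _)/cid2-/all_sig2[f f0 fC].
exists (\prod_i f i); first by apply/prodf_neq0 => i _; apply: f0.
move=> s; rewrite horner_prod => /prodf_neq0 fs i.
by apply: fC; apply: fs.
Qed.

Lemma cofin_poly (f : {poly R}) s0 : f.[s0] != 0 -> cofin (fun s => f.[s] != 0).
Proof.
by move=> fs0; exists f => //; apply: contraNneq fs0 => ->; rewrite horner0.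
Qed.

Lemma cofin_ex C : cofin C -> exists s, C s.
Proof.
move=> [f f0 fC]; pose rs : seq R := [seq i%:R | i <- iota 0 (size f)].
have [/allPn[s _ /fC]|] := boolP (~~ all (root f) rs); first by exists s.
rewrite negbK => rrs; have := max_poly_roots f0 rrs.
rewrite size_map size_iota ltnn => /(_ _)/negP[] //.
by rewrite map_inj_uniq ?iota_uniq // => i j /eqP; rewrite eqr_nat => /eqP.
Qed.

(** Injectivity at [s0] gives the coefficient matrix a one-sided inverse [B]; the determinant of the
    matrix at [s] times [B] is a polynomial in [s] with value 1 at [s0], and wherever it is nonzero
    injectivity holds. *)
Lemma cofin_injective (J K : finType) (F : K -> J -> {poly R}) s0 :
  (forall m : J -> R, (forall k, \sum_j (F k j).[s0] * m j = 0) -> m =1 fun=> 0) ->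
  cofin (fun s => forall m : J -> R,
    (forall k, \sum_j (F k j).[s] * m j = 0) -> m =1 fun=> 0).
Proof.
pose Mp := \matrix_(j < #|J|, k < #|K|) F (enum_val k) (enum_val j).
pose M s := map_mx (horner_eval s) Mp.
have kerM s (u : 'rV_#|J|) : (u *m M s = 0) <->
    (forall k, \sum_j (F k j).[s] * u 0 (enum_rank j) = 0).
  have uME k : (u *m M s) 0 k =
      \sum_j (F (enum_val k) j).[s] * u 0 (enum_rank j).
    rewrite mxE (reindex _ (onW_bij _ (@enum_val_bij J))).
    by apply: eq_bigr => i _; rewrite !mxE enum_valK horner_evalE mulrC.
  split=> [/rowP uM k|uM]; last by apply/rowP => k; rewrite uME uM mxE.
  by have := uM (enum_rank k); rewrite uME mxE enum_rankK.
move=> inj0.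
have /row_freeP[B MB] : row_free (M s0).
  rewrite -kermx_eq0; apply/eqP/row_matrixP => i; rewrite row0.
  have /kerM /inj0 z : row i (kermx (M s0)) *m M s0 = 0.
    by rewrite -row_mul mulmx_ker row0.
  by apply/rowP => j; have := z (enum_val j); rewrite enum_valK => ->; rewrite mxE.
pose f := \det (Mp *m map_mx polyC B).
have fE s : f.[s] = \det (M s *m B).
  rewrite -horner_evalE -det_map_mx map_mxM; congr (\det (_ *m _)).
  by apply/matrixP => i j; rewrite !mxE; apply: hornerC.
apply: (cofin_mono _ (@cofin_poly f s0 _)); last by rewrite fE MB det1 oner_neq0.
move=> s; rewrite fE => dM m mker j.
have /kerM uM : forall k, \sum_j (F k j).[s] * (\row_i m (enum_val i)) 0 (enum_rank j) = 0.
  by move=> k; rewrite -[RHS](mker k); apply: eq_bigr => i _; rewrite mxE enum_rankK.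
have u0 : (\row_i m (enum_val i) : 'rV_#|J|) = 0.
  have MBu : M s *m B \in unitmx by rewrite unitmxE unitfE.
  by rewrite -[LHS](mulmxK MBu) mulmxA uM !mul0mx.
by move/rowP/(_ (enum_rank j)): u0; rewrite !mxE enum_rankK.
Qed.

End Cofinite.

(** * Rational parametrisation of the circle, affine independence of its points *)

Section Circle.
Variable R : realFieldType.
Implicit Types (t z : R).

(** The half-angle parametrisation: being rational, it makes the rigidity equations polynomial once
    denominators are cleared. *)
Definition circx t : R := (1 - t ^+ 2) / (1 + t ^+ 2).
Definition circy t : R := 2 * t / (1 + t ^+ 2).

Lemma circ_den_neq0 t : 1 + t ^+ 2 != 0.
Proof. by rewrite gt_eqF // ltr_pwDl ?ltr01 // sqr_ge0. Qed.

Lemma circP t : circx t ^+ 2 + circy t ^+ 2 = 1.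
Proof. by rewrite /circx /circy; have := circ_den_neq0 t => t0; field. Qed.

Lemma circ_inj : injective (fun t => (circx t, circy t)).
Proof.
move=> s t [ex ey].
have tE u : u = circy u / (1 + circx u).
  rewrite /circx /circy; have u0 := circ_den_neq0 u; field.
  by rewrite u0; apply/andP; split; rewrite // gt_eqF //; lra.
by rewrite (tE s) (tE t) ex ey.
Qed.

Lemma circ_fresh (l : seq (R * R)) : exists t, (circx t, circy t) \notin l.
Proof.
pose h (i : nat) := (circx i%:R, circy i%:R) : R * R.
have [/allPn[p /mapP[i _ ->] il]|] :=
  boolP (~~ all (mem l) [seq h i | i <- iota 0 (size l).+1]); first by exists i%:R.
rewrite negbK => /allP sl.
have := uniq_leq_size _ sl; rewrite size_map size_iota ltnn => /(_ _)/negP[] //.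
rewrite map_inj_uniq ?iota_uniq // => i j /circ_inj/eqP.
by rewrite eqr_nat => /eqP.
Qed.

(** The dependency makes the chords from the third point proportional, so their squared lengths
    satisfy both [u1 * a = - u2 * b] and [u1 ^+ 2 * a = u2 ^+ 2 * b]; eliminating [a] leaves
    [u2 * (u1 + u2) * b = 0]. *)
Lemma circle_affine_free (x1 y1 x2 y2 x3 y3 u1 u2 u3 : R) :
  x1 ^+ 2 + y1 ^+ 2 = 1 -> x2 ^+ 2 + y2 ^+ 2 = 1 -> x3 ^+ 2 + y3 ^+ 2 = 1 ->
  (x1, y1) != (x2, y2) -> (x1, y1) != (x3, y3) -> (x2, y2) != (x3, y3) ->
  u1 + u2 + u3 = 0 -> u1 * x1 + u2 * x2 + u3 * x3 = 0 ->
  u1 * y1 + u2 * y2 + u3 * y3 = 0 -> [/\ u1 = 0, u2 = 0 & u3 = 0].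
Proof.
move=> c1 c2 c3 n12 n13 n23 su sx sy.
have sq0 (a b a' b' : R) : (a, b) != (a', b') -> (a - a') ^+ 2 + (b - b') ^+ 2 != 0.
  apply: contraNneq => /eqP; rewrite paddr_eq0 ?sqr_ge0 // !sqrf_eq0 !subr_eq0.
  by move=> /andP[/eqP-> /eqP->].
have u3E : u3 = - u1 - u2 by lra.
set a := (x1 - x3) ^+ 2 + (y1 - y3) ^+ 2; set b := (x2 - x3) ^+ 2 + (y2 - y3) ^+ 2.
have ex : u1 * (x1 - x3) = - u2 * (x2 - x3) by move: sx; rewrite u3E; lra.
have ey : u1 * (y1 - y3) = - u2 * (y2 - y3) by move: sy; rewrite u3E; lra.
(* On the unit circle a squared chord length is linear in the chord: minus twice its scalar product
   with the third point. *)
have ab1 : u1 * a = - u2 * b.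
  have -> : u1 * a = u1 * (x1 ^+ 2 + y1 ^+ 2 - (x3 ^+ 2 + y3 ^+ 2))
      - 2 * (x3 * (u1 * (x1 - x3)) + y3 * (u1 * (y1 - y3))) by rewrite /a; ring.
  rewrite ex ey.
  have -> : - u2 * b = - u2 * (x2 ^+ 2 + y2 ^+ 2 - (x3 ^+ 2 + y3 ^+ 2))
      - 2 * (x3 * (- u2 * (x2 - x3)) + y3 * (- u2 * (y2 - y3))) by rewrite /b; ring.
  by rewrite c1 c2 c3 !subrr !mulr0.
have ab2 : u1 ^+ 2 * a = u2 ^+ 2 * b.
  have -> : u1 ^+ 2 * a = (u1 * (x1 - x3)) ^+ 2 + (u1 * (y1 - y3)) ^+ 2 by rewrite /a; ring.
  by rewrite ex ey /b; ring.
have : u2 * (u1 + u2) * b = 0.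
  have -> : u2 * (u1 + u2) * b = u2 ^+ 2 * b - u1 * (- u2 * b) by ring.
  by rewrite -ab2 -ab1; ring.
move=> /eqP; rewrite !mulf_eq0 (negPf (sq0 _ _ _ _ n23)) orbF => /orP[] /eqP u0.
  move/eqP: ab1; rewrite u0 oppr0 mul0r mulf_eq0 (negPf (sq0 _ _ _ _ n13)) orbF => /eqP u10.
  by split; lra.
have u2E : u2 = - u1 by lra.
have : u1 * ((x1 - x2) ^+ 2 + (y1 - y2) ^+ 2) = 0.
  have -> : u1 * ((x1 - x2) ^+ 2 + (y1 - y2) ^+ 2) = (x1 - x2) * (u1 * (x1 - x3) - u1 * (x2 - x3))
     + (y1 - y2) * (u1 * (y1 - y3) - u1 * (y2 - y3)) by ring.
  by rewrite ex ey u2E opprK !subrr !mulr0 addr0.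
move=> /eqP; rewrite mulf_eq0 (negPf (sq0 _ _ _ _ n12)) orbF => /eqP u10.
by split; lra.
Qed.

End Circle.

(** * Sparse gain graphs *)

(* The gain graph of a free involution: [O] is the set of vertex orbits, the
   vertices above [i] are [(i, false)] and [(i, true)], and [(k, (i, j, g))]
   stands for the pair of edges joining [(i, b)] to [(j, b (+) g)].  Edges with
   tag [k = 0] get their coefficients from the positions of the vertices, edges
   with a positive tag are free: their two coefficients are arbitrary. *)
Notation gedge O := (nat * (O * O * bool))%type.

Section GainGraph.
Local Open Scope nat_scope.
Variable O : finType.

Definition tag (f : gedge O) := f.1.
Definition src (f : gedge O) := f.2.1.1.
Definition tgt (f : gedge O) := f.2.1.2.
Definition gain (f : gedge O) := f.2.2.

Implicit Types (L : seq (gedge O)) (X Y Z : {set O * bool}) (S : {set O}) (o : O).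

(** Sparsity is tested in the double cover, on sets that need not be invariant under the involution;
    [f] has two lifts there. *)
Definition cnt1 (f : gedge O) X : nat :=
  ((src f, false) \in X) && ((tgt f, gain f) \in X) +
  ((src f, true) \in X) && ((tgt f, ~~ gain f) \in X).
Definition cnt L X := \sum_(f <- L) cnt1 f X.
Definition sparse L := forall X, X != set0 -> cnt L X + 2 <= 2 * #|X|.
Definition tightset L X := cnt L X + 2 = 2 * #|X|.
(** Such a tight set is what forbids a new edge between the two vertices. *)
Definition bonded L y z := exists X, [/\ y \in X, z \in X & tightset L X].
Definition flip X : {set O * bool} := [set y | (y.1, ~~ y.2) \in X].

Lemma cnt_cat L1 L2 X : cnt (L1 ++ L2) X = cnt L1 X + cnt L2 X.
Proof. by rewrite /cnt big_cat. Qed.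

Lemma cnt_filter (a : pred (gedge O)) L X :
  cnt L X = cnt (filter a L) X + cnt (filter (predC a) L) X.
Proof. by rewrite -cnt_cat /cnt; apply: perm_big; rewrite perm_sym perm_filterC. Qed.

Lemma cnt_sub L X Y : X \subset Y -> cnt L X <= cnt L Y.
Proof.
move=> /subsetP XY; apply: leq_sum => f _; rewrite /cnt1.
apply: leq_add; case: andP => [[/XY-> /XY->]|] //.
Qed.

Lemma cnt_supermod L X Y : cnt L X + cnt L Y <= cnt L (X :|: Y) + cnt L (X :&: Y).
Proof.
rewrite /cnt -!big_split /=; apply: leq_sum => f _; rewrite /cnt1 !inE.
by do 8 case: (_ \in _).
Qed.

Lemma sparse_filter (a : pred (gedge O)) L : sparse L -> sparse (filter a L).
Proof. by move=> sL X /sL; rewrite (cnt_filter a L X); lia. Qed.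

Lemma tightset_cup L X Y y : sparse L -> y \in X -> y \in Y ->
  tightset L X -> tightset L Y -> tightset L (X :|: Y).
Proof.
move=> sL yX yY; rewrite /tightset => tX tY.
have /sL sI : X :&: Y != set0 by apply/set0Pn; exists y; rewrite inE yX.
have /sL sU : X :|: Y != set0 by apply/set0Pn; exists y; rewrite inE yX.
have := cnt_supermod L X Y; have := cardsUI X Y; lia.
Qed.

Lemma bonded_refl L y : sparse L -> bonded L y y.
Proof.
move=> sL; exists [set y]; rewrite set11; split=> //.
have /sL : [set y] != set0 by apply/set0Pn; exists y; rewrite set11.
by rewrite /tightset cards1; lia.
Qed.

Lemma card_flip X : #|flip X| = #|X|.
Proof.
have inj : injective (fun y : O * bool => (y.1, ~~ y.2)).
  by move=> [i b] [j c] [-> /negb_inj->].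
rewrite -(card_imset X inj); apply: eq_card => -[i b]; rewrite inE /=.
apply/idP/imsetP => [ibX|[[j c] jc [-> ->]]]; last by rewrite negbK.
by exists (i, ~~ b) => //=; rewrite negbK.
Qed.

Lemma cnt1_flip f X : cnt1 f (flip X) = cnt1 f X.
Proof. by rewrite /cnt1 !inE /= negbK addnC. Qed.

Lemma cnt_flip L X : cnt L (flip X) = cnt L X.
Proof. by apply: eq_bigr => f _; apply: cnt1_flip. Qed.

Lemma cnt_even L X : flip X = X -> ~~ odd (cnt L X).
Proof.
move=> fX; have fXE y b : ((y, ~~ b) \in X) = ((y, b) \in X) by rewrite -{2}fX inE.
rewrite /cnt; elim: L => [|f L IH]; first by rewrite big_nil.
rewrite big_cons oddD (negPf IH) addbF /cnt1.
by rewrite (fXE _ false) fXE addnn odd_double.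
Qed.

(** The new edge has two lifts. A set of slack one containing both needs a parity argument: its
    intersection and union with its flip are invariant, hence of even slack, and their slacks sum to
    at most two, so one of them is tight and bonds [y] with [z]. *)
Lemma sparse_add L k y z : sparse L -> ~ bonded L y z ->
  sparse ((k, (y.1, z.1, y.2 (+) z.2)) :: L).
Proof.
move=> sL nb X X0; rewrite /cnt big_cons -/(cnt L X); set f := (k, _).
have := sL X X0; rewrite leq_eqVlt => /predU1P[tX|]; last first.
  have [|] : cnt1 f X <= 1 \/ cnt1 f X = 2.
  - by rewrite /cnt1; case: (_ && _); case: (_ && _); [right|left|left|left].
  - by lia.
  rewrite /cnt1 /=; case: andP => [[a1 a2]|_]; case: andP => [[b1 b2]|_] // _ lt2.
  rewrite leqNgt; apply/negP => gt2.
  have inX i b : ((i, false) \in X -> (i, true) \in X -> (i, b) \in X) by case: b.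
  have yX b : (y.1, b) \in X by apply: inX.
  have zX b : (z.1, b) \in X.
    by move: a2 b2; rewrite /tgt /gain /f /=; case: (_ (+) _) => /= *; apply: inX.
  have inI : y \in X :&: flip X by rewrite !inE {1}[y]surjective_pairing !yX.
  have inI' : z \in X :&: flip X by rewrite !inE {1}[z]surjective_pairing !zX.
  have sI := sL (X :&: flip X) (introT (set0Pn _) (ex_intro _ y inI)).
  have inU : y \in X :|: flip X by move: inI; rewrite !inE => /andP[->].
  have inU' : z \in X :|: flip X by move: inI'; rewrite !inE => /andP[->].
  have sU := sL (X :|: flip X) (introT (set0Pn _) (ex_intro _ y inU)).
  have /dvdnP[r rE] : 2 %| cnt L (X :&: flip X).
    by rewrite dvdn2; apply: cnt_even; apply/setP => -[i b]; rewrite !inE /= negbK andbC.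
  have /dvdnP[t tE] : 2 %| cnt L (X :|: flip X).
    by rewrite dvdn2; apply: cnt_even; apply/setP => -[i b]; rewrite !inE /= negbK orbC.
  have := cnt_supermod L X (flip X); rewrite cnt_flip => sm.
  have := cardsUI X (flip X); rewrite card_flip => cUI.
  have [tI|tU] : tightset L (X :&: flip X) \/ tightset L (X :|: flip X).
  - have aux c x u i a b : c + 2 < 2 * x -> a + 2 <= 2 * i -> b + 2 <= 2 * u ->
        a = r * 2 -> b = t * 2 -> c + c <= b + a -> u + i = x + x ->
        2 * x < 1 + 1 + c + 2 -> a + 2 = 2 * i \/ b + 2 = 2 * u by lia.
    exact: (aux _ _ _ _ _ _ lt2 sI sU rE tE sm cUI gt2).
  - by apply: nb; exists (X :&: flip X).
  - by apply: nb; exists (X :|: flip X).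
(* For tight [X] both lifts are excluded, one by [X] and the other by [flip X]. *)
suff -> : cnt1 f X = 0 by lia.
have tfX : tightset L (flip X) by rewrite /tightset cnt_flip card_flip.
have nbX Y : tightset L Y -> (y \in Y) && (z \in Y) = false.
  by move=> tY; apply/negP => /andP[yY zY]; apply: nb; exists Y.
have := nbX _ tX; have := nbX _ tfX; rewrite /cnt1 /f /src /tgt /gain !inE /=.
by case: (y) (z) => [i []] [j []] /= -> ->.
Qed.

(** * Edges at an orbit and its deletion *)

Definition incident o (f : gedge O) := (src f == o) || (tgt f == o).
Definition loop (f : gedge O) := src f == tgt f.
(** The cover vertex that a non-loop [f] joins to [(o, false)]; gains of order two are their own
    inverses, so orientation does not affect the second component. *)
Definition far o (f : gedge O) : O * bool :=
  (if src f == o then tgt f else src f, gain f).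

Lemma cnt_not_incident o L X : {in L, forall f, ~~ incident o f} ->
  cnt L (X :\: [set y | y.1 == o]) = cnt L X.
Proof.
move=> nL; rewrite /cnt big_seq [RHS]big_seq; apply: eq_bigr => f /nL.
by rewrite /incident negb_or => /andP[/negPf so /negPf to]; rewrite /cnt1 !inE /= so to.
Qed.

(** Otherwise the two tight sets, meeting in the far end of [f2], have a tight union [U], and adding
    [(o, false)] to it brings three edges for one vertex. *)
Lemma far_not_bonded o L' f1 f2 f3 :
  sparse (f1 :: f2 :: f3 :: L') -> {in L', forall f, ~~ incident o f} ->
  {in [:: f1; f2; f3], forall f, incident o f && ~~ loop f} ->
  bonded L' (far o f1) (far o f2) -> ~ bonded L' (far o f2) (far o f3).
Proof.
move=> sL nL' iL [X [X1 X2 tX]] [Y [Y2 Y3 tY]].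
have sL' : sparse L'.
  by move=> Z /sL; rewrite /cnt !big_cons; lia.
have tU := tightset_cup sL' X2 Y2 tX tY.
move: (X :|: Y) (subsetUl X Y) (subsetUr X Y) tU => U /subsetP XU /subsetP YU tU.
have U1 := XU _ X1; have U2 := XU _ X2; have U3 := YU _ Y3.
have far_o f : incident o f && ~~ loop f -> (far o f).1 != o.
  rewrite /incident /loop /far /=; case: eqP => [->|] //=; first by rewrite eq_sym.
  by move/eqP.
(* Vertices above [o] carry no edge of [L'], so removing them from a tight set would break
   sparsity. *)
have oU b : (o, b) \notin U.
  apply/negP => obU; pose U' := U :\: [set y | y.1 == o].
  have U'U : U' \proper U.
    by apply/properP; split; [apply: subsetDl | exists (o, b); rewrite // !inE /= eqxx].
  have /sL' : U' != set0.
    apply/set0Pn; exists (far o f1); rewrite in_setD U1 andbT inE.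
    by apply: far_o; apply: iL; rewrite inE eqxx.
  rewrite cnt_not_incident //; have := proper_card U'U; move: tU; rewrite /tightset; lia.
have one f : incident o f && ~~ loop f -> far o f \in U -> 1 <= cnt1 f ((o, false) |: U).
  rewrite /incident /loop /far /cnt1 !inE !xpair_eqE.
  case: eqP => [->|_] /=; first by move=> _ fU; rewrite fU orbT.
  by case/andP=> /eqP-> _; rewrite eqxx /=; case: (gain f) => /= ->; rewrite ?orbT ?addn1.
have /sL : (o, false) |: U != set0 by apply/set0Pn; exists (o, false); rewrite !inE eqxx.
rewrite /cnt !big_cons -/(cnt L' _) cardsU1 oU.
have := one _ (iL f1 _) U1; have := one _ (iL f2 _) U2; have := one _ (iL f3 _) U3.
rewrite !inE !eqxx !orbT => /(_ isT) ? /(_ isT) ? /(_ isT) ?.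
have := cnt_sub L' (subsetUr [set (o, false)] U); move: tU; rewrite /tightset; lia.
Qed.

(** Only position edges must be simple, since parallel ones share their equation. The last equation
    is half the tight count of the cover, which has [2 * #|S|] vertices and two edges per element of
    [L]. *)
Definition wf S L := [/\ uniq L, {in L, forall f, (src f \in S) && (tgt f \in S)},
  {in L, forall f, tag f = 0 -> ~~ loop f && ((0, (tgt f, src f, gain f)) \notin L)},
  sparse L & (size L).+1 = 2 * #|S|].

Lemma sum_const_on L (F : gedge O -> nat) c :
  (forall f, f \in L -> F f = c) -> \sum_(f <- L) F f = c * size L.
Proof.
move=> Fc; rewrite big_seq (eq_bigr (fun=> c)) // -big_seq.
by rewrite big_const_seq count_predT iter_addn_0.
Qed.

(** The degrees, loops counted twice, sum to [4 * #|S| - 2]. *)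
Lemma exists_low_degree S L : wf S L -> exists2 o, o \in S &
  \sum_(f <- L) ((src f == o) + (tgt f == o)) <= 3.
Proof.
case=> _ inS _ _ sz; apply/exists_inP; apply: contraT.
rewrite negb_exists_in => /forall_inP deg4.
have : 4 * #|S| <= \sum_(o in S) \sum_(f <- L) ((src f == o) + (tgt f == o)).
  by rewrite mulnC -sum_nat_const; apply: leq_sum => o /deg4; rewrite -ltnNge.
rewrite exchange_big /= (@sum_const_on _ _ 2); first by lia.
move=> f /inS/andP[sS tS]; rewrite big_split /=.
have one (x : O) : x \in S -> \sum_(o in S) (x == o) = 1.
  move=> xS; rewrite (bigD1 x) //= eqxx big1 // => o /andP[_].
  by rewrite eq_sym => /negPf->.
by rewrite !one.
Qed.

Definition rest o L := [seq f <- L | ~~ incident o f].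

Lemma wf_rest_ends o S L : wf S L -> {in rest o L, forall f, (src f \in S :\ o) && (tgt f \in S :\ o)}.
Proof.
case=> _ inS _ _ _ f; rewrite mem_filter /incident negb_or => /andP[/andP[so to] /inS/andP[sS tS]].
by rewrite !inE so to sS tS.
Qed.

(** Sparsity of the cover of [S :\ o] bounds the remaining edges, so at least two edges meet [o]. *)
Lemma size_rest S L o : wf S L -> o \in S -> 1 < #|S| ->
  size (rest o L) + 2 <= size L.
Proof.
move=> wfL oS S1; have re := wf_rest_ends (o := o) wfL; case: wfL => _ _ _ sL sz.
pose X := [set y : O * bool | y.1 \in S :\ o].
have cX : #|X| = 2 * #|S|.-1.
  have -> : X = setX (S :\ o) [set: bool] by apply/setP => -[i b]; rewrite !inE /= andbT.
  by rewrite cardsX cardsT card_bool (cardsD1 o S) oS mulnC.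
have /(@sparse_filter (fun f => ~~ incident o f) L sL) : X != set0.
  by rewrite -card_gt0 cX; lia.
have -> : cnt (rest o L) X = 2 * size (rest o L).
  rewrite /cnt (@sum_const_on _ _ 2) // => f /re/andP[sS tS].
  by rewrite /cnt1 !(in_set (fun y : O * bool => y.1 \in S :\ o)) /= sS tS.
rewrite cX; lia.
Qed.

Lemma wf_rest S L o : wf S L -> o \in S -> size (rest o L) + 2 = size L ->
  wf (S :\ o) (rest o L).
Proof.
move=> wfL oS sz2; have re := wf_rest_ends (o := o) wfL.
case: wfL => uL _ simL sL sz; split=> //; first exact: filter_uniq.
- move=> f; rewrite mem_filter => /andP[_ fL] /(simL f fL)/andP[-> /=].
  by apply: contra; rewrite mem_filter => /andP[].
- exact: sparse_filter.
- by move: sz; rewrite (cardsD1 o S) oS; lia.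
Qed.

(** Deleting an orbit with three edges loses one edge too many, which the new one repays. Its fresh
    tag keeps it distinct from any parallel edge. *)
Lemma wf_rest_add S L o k y z : wf S L -> o \in S -> size (rest o L) + 3 = size L ->
  y.1 \in S :\ o -> z.1 \in S :\ o -> 0 < k -> {in L, forall f, tag f != k} ->
  ~ bonded (rest o L) y z ->
  wf (S :\ o) ((k, (y.1, z.1, y.2 (+) z.2)) :: rest o L).
Proof.
move=> wfL oS sz3 yS zS k0 kL nb; have re := wf_rest_ends (o := o) wfL.
case: wfL => uL _ simL sL sz; split.
- rewrite /= filter_uniq // andbT; apply/negP; rewrite mem_filter => /andP[_ /kL].
  by rewrite /tag eqxx.
- by move=> f; rewrite in_cons => /predU1P[->|/re//]; rewrite /src /tgt /= yS.
- move=> f; rewrite in_cons => /predU1P[->|]; first by rewrite /tag /=; lia.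
  rewrite mem_filter => /andP[_ fL] /(simL f fL)/andP[-> /= nf].
  rewrite in_cons negb_or mem_filter (negPf nf) andbF andbT xpair_eqE.
  by rewrite eq_sym (gtn_eqF k0).
- by apply: sparse_add => //; apply: sparse_filter.
- by move: sz; rewrite (cardsD1 o S) oS /=; lia.
Qed.

End GainGraph.

(** * Placing a new vertex *)

Section Rows.
Variable R : realFieldType.

(** Test directions: the first two determine a linear form, all three a binary quadratic form. *)
Let sampleE : [/\ (circx 0, circy 0) = (1, 0) :> R * R, (circx 1, circy 1) = (0, 1) :> R * R
  & (circx 2, circy 2) = (- (3 / 5), 4 / 5) :> R * R].
Proof.
rewrite /circx /circy; split; congr pair; try by field.
all: by field; rewrite ?pnatr_eq0 // gt_eqF //; lra.
Qed.

Lemma generic_row (z1 x1 y1 : R) : x1 ^+ 2 + y1 ^+ 2 = 1 ->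
  exists z t, z - z1 != 0 /\ circy t * x1 - circx t * y1 != 0.
Proof.
case: sampleE => [[X0 Y0] [X1 Y1] _] u1; exists (z1 + 1).
have [x0|x0] := eqVneq x1 0; [exists 0|exists 1]; split; try by rewrite addrC addKr oner_eq0.
  rewrite X0 Y0 mul0r sub0r mul1r oppr_eq0; apply: contra_eqN u1 => /eqP->.
  by rewrite x0 expr0n addr0 eq_sym oner_eq0.
by rewrite X1 Y1 mul0r subr0 mul1r.
Qed.

Lemma generic_two_rows (z1 x1 y1 z2 x2 y2 : R) : (x1, y1) != (x2, y2) ->
  exists z t, forall a b,
    (z - z1) * a + (circy t * x1 - circx t * y1) * b = 0 ->
    (z - z2) * a + (circy t * x2 - circx t * y2) * b = 0 -> a = 0 /\ b = 0.
Proof.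
move=> n12; apply/not_existsP => noz.
(* The determinant of the two rows, affine in [z] and linear in the point; four positions where it
   vanishes force the two given points to agree. *)
pose D z X Y : R := (z - z1) * (Y * x2 - X * y2) - (z - z2) * (Y * x1 - X * y1).
have D0 z t : D z (circx t) (circy t) = 0.
  apply/eqP/negP => /negP D0; apply: (noz z); exists t => a b e1 e2.
  have sol u : D z (circx t) (circy t) * u = 0 -> u = 0.
    by move/eqP; rewrite mulf_eq0 (negPf D0) => /eqP.
  split; apply: sol.
    transitivity ((circy t * x2 - circx t * y2) * ((z - z1) * a + (circy t * x1 - circx t * y1) * b)
      - (circy t * x1 - circx t * y1) * ((z - z2) * a + (circy t * x2 - circx t * y2) * b)).
      by rewrite /D; ring.
    by rewrite e1 e2 !mulr0 subrr.
  transitivity ((z - z1) * ((z - z2) * a + (circy t * x2 - circx t * y2) * b)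
    - (z - z2) * ((z - z1) * a + (circy t * x1 - circx t * y1) * b)).
    by rewrite /D; ring.
  by rewrite e1 e2 !mulr0 subrr.
have [[X0 Y0] [X1 Y1] _] := sampleE.
have := D0 0 0; have := D0 1 0; have := D0 0 1; have := D0 1 1.
rewrite X0 Y0 X1 Y1 /D => h1 h2 h3 h4; move/eqP: n12; apply; congr pair; lra.
Qed.

(* Vanishing of the determinant for every position [(z, t)] of the new vertex
   forces both difference vectors of the [Wk] and of the [Omk] to be affine
   dependencies among three points of the circle. *)
Lemma generic_three_rows (z1 x1 y1 z2 x2 y2 z3 x3 y3 W1 W2 W3 Om1 Om2 Om3 : R) :
  x1 ^+ 2 + y1 ^+ 2 = 1 -> x2 ^+ 2 + y2 ^+ 2 = 1 -> x3 ^+ 2 + y3 ^+ 2 = 1 ->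
  (x1, y1) != (x2, y2) -> (x1, y1) != (x3, y3) -> (x2, y2) != (x3, y3) ->
  ~ [/\ W1 = W2, W2 = W3, Om1 = Om2 & Om2 = Om3] ->
  exists z t, forall a b c,
    (z - z1) * (a - c * W1) + (circy t * x1 - circx t * y1) * (b - c * Om1) = 0 ->
    (z - z2) * (a - c * W2) + (circy t * x2 - circx t * y2) * (b - c * Om2) = 0 ->
    (z - z3) * (a - c * W3) + (circy t * x3 - circx t * y3) * (b - c * Om3) = 0 ->
    [/\ a = 0, b = 0 & c = 0].
Proof.
move=> u1 u2 u3 n12 n13 n23 ne; apply/not_existsP => noz; apply: ne.
pose det3 a1 b1 c1 a2 b2 c2 a3 b3 c3 : R :=
  a1 * (b2 * c3 - b3 * c2) - b1 * (a2 * c3 - a3 * c2) + c1 * (a2 * b3 - a3 * b2).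
pose D z X Y : R :=
  det3 (z - z1) (Y * x1 - X * y1) ((z - z1) * W1 + (Y * x1 - X * y1) * Om1)
       (z - z2) (Y * x2 - X * y2) ((z - z2) * W2 + (Y * x2 - X * y2) * Om2)
       (z - z3) (Y * x3 - X * y3) ((z - z3) * W3 + (Y * x3 - X * y3) * Om3).
have cramer a1 b1 c1 a2 b2 c2 a3 b3 c3 a b c :
    det3 a1 b1 c1 a2 b2 c2 a3 b3 c3 != 0 ->
    a1 * a + b1 * b - c1 * c = 0 -> a2 * a + b2 * b - c2 * c = 0 ->
    a3 * a + b3 * b - c3 * c = 0 -> [/\ a = 0, b = 0 & c = 0].
  move=> d0 e1 e2 e3.
  have sol u : det3 a1 b1 c1 a2 b2 c2 a3 b3 c3 * u = 0 -> u = 0.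
    by move/eqP; rewrite mulf_eq0 (negPf d0) => /eqP.
  split; apply: sol; rewrite /det3.
  - transitivity ((b2 * c3 - b3 * c2) * (a1 * a + b1 * b - c1 * c)
      - (b1 * c3 - b3 * c1) * (a2 * a + b2 * b - c2 * c)
      + (b1 * c2 - b2 * c1) * (a3 * a + b3 * b - c3 * c)); first by ring.
    by rewrite e1 e2 e3; ring.
  - transitivity (- (a2 * c3 - a3 * c2) * (a1 * a + b1 * b - c1 * c)
      + (a1 * c3 - a3 * c1) * (a2 * a + b2 * b - c2 * c)
      - (a1 * c2 - a2 * c1) * (a3 * a + b3 * b - c3 * c)); first by ring.
    by rewrite e1 e2 e3; ring.
  - transitivity (- (a2 * b3 - a3 * b2) * (a1 * a + b1 * b - c1 * c)
      + (a1 * b3 - a3 * b1) * (a2 * a + b2 * b - c2 * c)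
      - (a1 * b2 - a2 * b1) * (a3 * a + b3 * b - c3 * c)); first by ring.
    by rewrite e1 e2 e3; ring.
have D0 z t : D z (circx t) (circy t) = 0.
  apply/eqP/negP => /negP D0; apply: (noz z); exists t => a b c e1 e2 e3.
  apply: (cramer _ _ _ _ _ _ _ _ _ _ _ _ D0).
  - by rewrite -[RHS]e1; ring.
  - by rewrite -[RHS]e2; ring.
  - by rewrite -[RHS]e3; ring.
have [[X0 Y0] [X1 Y1] [X2 Y2]] := sampleE.
have D10 z : D z 1 0 = 0 by have := D0 z 0; rewrite X0 Y0.
have D01 z : D z 0 1 = 0 by have := D0 z 1; rewrite X1 Y1.
have D34 z : D z (- (3 / 5)) (4 / 5) = 0 by have := D0 z 2; rewrite X2 Y2.
(* The second difference isolates the coefficient of [z ^+ 2], which is linear in the point and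
   involves only the [Wk]. *)
have D2 X Y : D 1 X Y + D (-1) X Y - 2 * D 0 X Y =
    2 * ((W2 - W3) * (Y * x1 - X * y1) + (W3 - W1) * (Y * x2 - X * y2)
       + (W1 - W2) * (Y * x3 - X * y3)) by rewrite /D /det3; ring.
have [||//|w1 w2 w3] := @circle_affine_free _ x1 y1 x2 y2 x3 y3 (W2 - W3) (W3 - W1) (W1 - W2)
  u1 u2 u3 n12 n13 n23 _ _ _; first by ring.
- have := D2 0 1; rewrite !D01; lra.
- have := D2 1 0; rewrite !D10; lra.
have W12 : W2 = W1 by lra.
have W13 : W3 = W1 by lra.
(* Equal [Wk] contribute a multiple of the first column and drop out; the coefficient of [z] is then
   a quadratic form in the point. *)
have D1 X Y : D 1 X Y - D (-1) X Y =
    2 * ((Om3 - Om2) * ((Y * x2 - X * y2) * (Y * x3 - X * y3))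
       + (Om1 - Om3) * ((Y * x3 - X * y3) * (Y * x1 - X * y1))
       + (Om2 - Om1) * ((Y * x1 - X * y1) * (Y * x2 - X * y2))).
  by rewrite /D /det3 W12 W13; ring.
set v1 := Om3 - Om2; set v2 := Om1 - Om3; set v3 := Om2 - Om1.
have qyy : v1 * (y2 * y3) + v2 * (y3 * y1) + v3 * (y1 * y2) = 0.
  have := D1 1 0; rewrite !D10 /v1 /v2 /v3; lra.
have qxx : v1 * (x2 * x3) + v2 * (x3 * x1) + v3 * (x1 * x2) = 0.
  have := D1 0 1; rewrite !D01 /v1 /v2 /v3; lra.
have qxy : v1 * (x2 * y3 + x3 * y2) + v2 * (x3 * y1 + x1 * y3) + v3 * (x1 * y2 + x2 * y1) = 0.
  (* The pure terms enter with weights 32/25 and 18/25, the mixed one with 24/25. *)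
  have := D1 (- (3 / 5)) (4 / 5); rewrite !D34 -/v1 -/v2 -/v3 => e.
  transitivity (((2 * (v1 * ((4 / 5 * x2 - - (3 / 5) * y2) * (4 / 5 * x3 - - (3 / 5) * y3)) +
    v2 * ((4 / 5 * x3 - - (3 / 5) * y3) * (4 / 5 * x1 - - (3 / 5) * y1)) +
    v3 * ((4 / 5 * x1 - - (3 / 5) * y1) * (4 / 5 * x2 - - (3 / 5) * y2))) -
    32 / 25 * (v1 * (x2 * x3) + v2 * (x3 * x1) + v3 * (x1 * x2)) -
    18 / 25 * (v1 * (y2 * y3) + v2 * (y3 * y1) + v3 * (y1 * y2))) * (25 / 24))); first by field.
  by rewrite -e qxx qyy; ring.
(* Multiplying [sum v1 e^(i(t2+t3)) = 0] by [e^(-i(t1+t2+t3))] gives [sum v1 e^(-i t1) = 0]. *)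
pose re := x1 * x2 * x3 - x1 * y2 * y3 - y1 * x2 * y3 - y1 * y2 * x3.
pose im := y1 * x2 * x3 + x1 * y2 * x3 + x1 * x2 * y3 - y1 * y2 * y3.
pose C := v1 * (x2 * x3) + v2 * (x3 * x1) + v3 * (x1 * x2)
  - (v1 * (y2 * y3) + v2 * (y3 * y1) + v3 * (y1 * y2)).
pose S := v1 * (x2 * y3 + x3 * y2) + v2 * (x3 * y1 + x1 * y3) + v3 * (x1 * y2 + x2 * y1).
have C0 : C = 0 by rewrite /C qxx qyy subrr.
have S0 : S = 0 by [].
have [||//|o1 o2 o3] := @circle_affine_free _ x1 y1 x2 y2 x3 y3 v1 v2 v3
  u1 u2 u3 n12 n13 n23 _ _ _; first by rewrite /v1 /v2 /v3; ring.
- transitivity (re * C + im * S); last by rewrite C0 S0 !mulr0 addr0.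
  transitivity (v1 * x1 * (x2 ^+ 2 + y2 ^+ 2) * (x3 ^+ 2 + y3 ^+ 2)
    + v2 * x2 * (x1 ^+ 2 + y1 ^+ 2) * (x3 ^+ 2 + y3 ^+ 2)
    + v3 * x3 * (x1 ^+ 2 + y1 ^+ 2) * (x2 ^+ 2 + y2 ^+ 2)); first by rewrite u1 u2 u3 !mulr1.
  by rewrite /re /im /C /S; ring.
- transitivity (im * C - re * S); last by rewrite C0 S0 !mulr0 subrr.
  transitivity (v1 * y1 * (x2 ^+ 2 + y2 ^+ 2) * (x3 ^+ 2 + y3 ^+ 2)
    + v2 * y2 * (x1 ^+ 2 + y1 ^+ 2) * (x3 ^+ 2 + y3 ^+ 2)
    + v3 * y3 * (x1 ^+ 2 + y1 ^+ 2) * (x2 ^+ 2 + y2 ^+ 2)); first by rewrite u1 u2 u3 !mulr1.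
  by rewrite /re /im /C /S; ring.
by move: o1 o2 o3; rewrite /v1 /v2 /v3 => o1 o2 o3; split; lra.
Qed.

End Rows.

(** * Rigidity of gain graphs *)

Section GainRigidity.
Variables (R : realFieldType) (O : finType).
Implicit Types (q : O -> R * R) (c : gedge O -> R * R) (w om : O -> R) (f : gedge O)
  (S : {set O}) (L : seq (gedge O)) (o : O) (y : O * bool) (eps : bool).

Definition sg (b : bool) : R := if b then -1 else 1.
(** The inversion reverses axial velocities and preserves angular ones: an invariant motion has odd
    [w] and even [om], an anti-invariant one the opposite. *)
Definition sw eps b := sg (eps && b).
Definition so eps b := sg (~~ eps && b).

Definition hgt q y := sg y.2 * (q y.1).1.
Definition ptx q y := sg y.2 * circx (q y.1).2.
Definition pty q y := sg y.2 * circy (q y.1).2.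
Definition pcoef q y y' : R * R :=
  (hgt q y - hgt q y', pty q y * ptx q y' - ptx q y * pty q y').
Definition coef q c f := if tag f == 0%N then pcoef q (src f, false) (tgt f, gain f) else c f.

(* The axial velocity [w] and the angular velocity [om] are extended to the
   fibre of each orbit: for [eps = true] the extension describes the velocities
   invariant under the inversion, for [eps = false] the anti-invariant ones. *)
Definition liftw eps w y := sw eps y.2 * w y.1.
Definition lifto eps om y := so eps y.2 * om y.1.
Definition eqrow eps (a : R * R) i y w om :=
  a.1 * (w i - liftw eps w y) + a.2 * (om i - lifto eps om y).
Definition eqn eps a f w om := eqrow eps a (src f) (tgt f, gain f) w om.
Definition flex eps q c L w om := forall f, f \in L -> eqn eps (coef q c f) f w om = 0.
(** On nonempty [S] the sign change between sheets forces [A = 0] if [eps], and [B = 0] otherwise: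
    rotations are invariant, axial translations anti-invariant. *)
Definition const_on eps S w om A B :=
  forall i b, i \in S -> liftw eps w (i, b) = A /\ lifto eps om (i, b) = B.
Definition rigid eps q c S L := forall w om, flex eps q c L w om ->
  exists A B, const_on eps S w om A B.

Lemma pt_unit q y : ptx q y ^+ 2 + pty q y ^+ 2 = 1.
Proof. by rewrite /ptx /pty /sg; case: y.2; rewrite ?mulN1r ?mul1r ?sqrrN circP. Qed.

(** The equation changes only by a sign, so each position edge at [o] can be read as leaving
    [(o, false)]. *)
Lemma row_swap_pos eps q i o b w om :
  eqrow eps (pcoef q (i, false) (o, b)) i (o, b) w om =
  so eps b * eqrow eps (pcoef q (o, false) (i, b)) o (i, b) w om.
Proof.
rewrite /eqrow /pcoef /liftw /lifto /sw /so /hgt /ptx /pty /=.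
by case: eps; case: b; rewrite /sg /=; ring.
Qed.

Lemma row_swap_free eps a i o b w om :
  eqrow eps (- sw eps b * a.1, - so eps b * a.2) i (o, b) w om = eqrow eps a o (i, b) w om.
Proof.
rewrite /eqrow /liftw /lifto /sw /so /=.
by case: eps; case: b; rewrite /sg /=; ring.
Qed.

Lemma sg_neq0 b : sg b != 0.
Proof. by case: b; rewrite /sg ?oppr_eq0 oner_eq0. Qed.

Lemma eqn_far_pos eps q o f w om : incident o f -> ~~ loop f ->
  eqn eps (pcoef q (src f, false) (tgt f, gain f)) f w om = 0 <->
  eqrow eps (pcoef q (o, false) (far o f)) o (far o f) w om = 0.
Proof.
rewrite /incident /loop /eqn /far; case: eqP => [->//|_] /= /eqP-> _.
rewrite row_swap_pos; split=> [/eqP|->]; last by rewrite mulr0.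
by rewrite mulf_eq0 (negPf (sg_neq0 _)) => /eqP.
Qed.

Lemma eqn_far_free eps o f (a : R * R) : incident o f -> ~~ loop f ->
  exists a', forall w om, eqn eps a' f w om = eqrow eps a o (far o f) w om.
Proof.
rewrite /incident /loop /eqn /far; case: eqP => [->|_] /=; first by exists a.
move=> /eqP-> _; exists (- sw eps (gain f) * a.1, - so eps (gain f) * a.2) => w om.
exact: row_swap_free.
Qed.

(* The new vertex [o] is placed at [(z, t)]; a free edge at [o] gets the
   coefficients of an edge joining [o] to the point [P f] at height [h f]. *)
Lemma extend eps q c o z t (h : gedge O -> R) (P : gedge O -> R * R) :
  (forall f, incident o f -> ~~ loop f -> tag f = 0%N ->
    h f = hgt q (far o f) /\ P f = (ptx q (far o f), pty q (far o f))) ->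
  exists q' c', [/\ forall f, ~~ incident o f -> coef q' c' f = coef q c f,
    forall f, incident o f -> loop f -> tag f != 0%N -> coef q' c' f = (1, 1) &
    forall f w om, incident o f -> ~~ loop f -> eqn eps (coef q' c' f) f w om = 0 ->
      eqrow eps (z - h f, circy t * (P f).1 - circx t * (P f).2) o (far o f) w om = 0].
Proof.
move=> hP; pose q' i := if i == o then (z, t) else q i.
have q'E y : y.1 != o -> [/\ hgt q' y = hgt q y, ptx q' y = ptx q y & pty q' y = pty q y].
  by rewrite /hgt /ptx /pty /q' => /negPf->.
have q'o : pcoef q' (o, false) = fun y => (z - hgt q' y, circy t * ptx q' y - circx t * pty q' y).
  by apply/funext => y; rewrite /pcoef /hgt /ptx /pty /q' /= eqxx /= !mul1r.
have free f : exists a, incident o f -> ~~ loop f -> forall w om, eqn eps a f w om =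
    eqrow eps (z - h f, circy t * (P f).1 - circx t * (P f).2) o (far o f) w om.
  case: (boolP (incident o f && ~~ loop f)) => [/andP[fi fl]|].
    by have [a aE] := eqn_far_free eps (z - h f, circy t * (P f).1 - circx t * (P f).2) fi fl; exists a.
  by move=> nn; exists 0 => fi fl; rewrite fi fl in nn.
case/choice: free => a aE.
exists q', (fun f => if incident o f then if loop f then (1, 1) else a f else c f).
split=> [f|f fi fl t0|f w om fi fl]; rewrite /coef.
- rewrite /incident negb_or => /andP[so to]; case: ifP => _ //; last by rewrite (negPf so) (negPf to).
  have [e1 e2 e3] := q'E (src f, false) so; have [e4 e5 e6] := q'E (tgt f, gain f) to.
  by rewrite /pcoef e1 e2 e3 e4 e5 e6.
- by rewrite (negPf t0) fi fl.
have far_o : (far o f).1 != o.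
  move: fi fl; rewrite /incident /loop /far /=; case: eqP => [->|] //=; first by rewrite eq_sym.
  by move/eqP.
case: ifP => [/eqP t0|_]; last by rewrite fi (negPf fl) aE.
move/eqn_far_pos => /(_ _ fi fl); rewrite q'o.
have [-> -> ->] := q'E _ far_o; have [<- pE] := hP f fi fl t0.
by rewrite pE.
Qed.

(** Distinct orbits thus have neither equal nor antipodal projections. *)
Definition generic q := injective (fun y => (ptx q y, pty q y)).

(** Position edges have prescribed points, distinct by genericity; free edges receive unoccupied
    ones, so the placement lemmas for distinct points apply to both kinds. *)
Lemma fresh_points q (p : gedge O -> O * bool) (fs : seq (gedge O)) : generic q ->
  {in fs &, forall f f', tag f = 0%N -> tag f' = 0%N -> p f = p f' -> f = f'} ->
  exists P : gedge O -> R * R, [/\ forall f, tag f = 0%N -> P f = (ptx q (p f), pty q (p f)),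
    forall f, (P f).1 ^+ 2 + (P f).2 ^+ 2 = 1 & {in fs &, injective P}].
Proof.
move=> gq pinj; pose pt y := (ptx q y, pty q y).
(* Strengthened for the induction: points of free edges avoid every projected vertex, so a position
   edge added later cannot collide with them. *)
suff [P [P1 P2 P3 _]] : exists P : gedge O -> R * R,
   [/\ forall f, tag f = 0%N -> P f = pt (p f), forall f, (P f).1 ^+ 2 + (P f).2 ^+ 2 = 1,
    {in fs &, injective P} & {in fs, forall f, tag f != 0%N -> P f \notin codom pt}].
  by exists P.
elim: fs pinj => [|f fs IH] pinj.
  exists (fun f => if tag f == 0%N then pt (p f) else (1, 0)); split=> //.
    by move=> f ->.
  by move=> f; case: ifP => _; [apply: pt_unit | rewrite /= expr1n expr0n addr0].
have [|P [P1 P2 P3 P4]] := IH.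
  by move=> a b ain bin; apply: pinj; rewrite in_cons (ain, bin) orbT.
have [ffs|ffs] := boolP (f \in fs).
  have sub a : a \in f :: fs -> a \in fs by rewrite in_cons => /predU1P[->|].
  by exists P; split=> // [a b /sub afs /sub bfs|a /sub afs]; [apply: P3 | apply: P4].
have [t0|t0] := eqVneq (tag f) 0%N.
  exists P; split=> // [a b|a]; rewrite !in_cons; last by case/predU1P=> [->|]; [rewrite t0 | apply: P4].
  have ne b' : b' \in fs -> P f = P b' -> f = b'.
    move=> b'fs; rewrite P1 //; have [t0'|t0'] := eqVneq (tag b') 0%N; last first.
      by move=> e; have := P4 _ b'fs t0'; rewrite -e codom_f.
    rewrite P1 // => /gq; apply: pinj => //; rewrite in_cons ?eqxx ?b'fs ?orbT //.
  by move=> /predU1P[->|afs] /predU1P[->|bfs] //; [apply: ne | move/esym/(ne _ afs) | apply: P3].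
have [t tn] := circ_fresh (codom pt ++ map P fs).
move: tn; rewrite mem_cat negb_or => /andP[tn1 tn2].
exists (fun a => if a == f then (circx t, circy t) else P a); split.
- by move=> a ta; case: eqP => [af|_]; [rewrite -af ta in t0 | apply: P1].
- by move=> a; case: eqP => _; [apply: circP | apply: P2].
- have ne b : b \in fs -> (circx t, circy t) = P b -> f = b.
    by move=> bfs e; rewrite e map_f in tn2.
  have nf b : b \in fs -> (b == f) = false by move=> bfs; apply: contraNF ffs => /eqP<-.
  move=> a b; rewrite !in_cons => /predU1P[->|afs] /predU1P[->|bfs] //; rewrite ?eqxx ?nf //.
  + exact: ne.
  + by move/esym/(ne _ afs).
  + exact: P3.
- move=> a; rewrite in_cons; case: eqP => [-> _ _//|_] /=.
  exact: P4.
Qed.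

End GainRigidity.

(** * Genericity and rigidity along a line of positions *)

Section Genericity.
Variables (R : realFieldType) (O : finType).
Implicit Types (q : O -> R * R) (c : gedge O -> R * R) (w om : O -> R) (f : gedge O)
  (S : {set O}) (L : seq (gedge O)) (o r : O) (eps : bool).

Definition line q0 q1 (s : R) i : R * R :=
  ((q0 i).1 + s * ((q1 i).1 - (q0 i).1), (q0 i).2 + s * ((q1 i).2 - (q0 i).2)).

Lemma line0 q0 q1 : line q0 q1 0 = q0.
Proof. by apply/funext => i; rewrite /line !mul0r !addr0 -surjective_pairing. Qed.

Lemma line1 q0 q1 : line q0 q1 1 = q1.
Proof. by apply/funext => i; rewrite /line [RHS]surjective_pairing; congr pair; ring. Qed.

(** In half-angle parameters the sine of an angle difference is a positive multiple of this product,
    whose factors vanish for equal and for antipodal points. *)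
Lemma generic_cond q :
  (forall i j, i != j -> ((q j).2 - (q i).2) * (1 + (q i).2 * (q j).2) != 0) -> generic q.
Proof.
move=> qij [i b] [j b'] [ex ey].
have [ij|/qij/eqP[]] := eqVneq i j.
  move: ex ey; rewrite -ij; case: (eqVneq b b') => [-> //|bb'] ex ey.
  have := pt_unit q (i, b); have : ptx q (i, b) = 0 /\ pty q (i, b) = 0.
    by move: ex ey; rewrite /ptx /pty /sg /=; case: b b' bb' => [] [] //= _; lra.
  by move=> [-> ->] /eqP; rewrite expr0n addr0 eq_sym oner_eq0.
move: ex ey; rewrite /ptx /pty /=; set ti := (q i).2; set tj := (q j).2 => ex ey.
have cr : circx ti * circy tj - circy ti * circx tj = 0.
  apply/eqP; rewrite -(mulrI_eq0 _ (mulfI (mulf_neq0 (sg_neq0 R b) (sg_neq0 R b')))).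
  apply/eqP; transitivity ((sg R b * circx ti) * (sg R b' * circy tj)
    - (sg R b * circy ti) * (sg R b' * circx tj)); first by ring.
  by rewrite ex ey; ring.
transitivity ((1 + ti ^+ 2) * (1 + tj ^+ 2) / 2 * (circx ti * circy tj - circy ti * circx tj)); last by rewrite cr mulr0.
rewrite /circx /circy; have := circ_den_neq0 ti; have := circ_den_neq0 tj => h1 h2.
by field; rewrite h1 h2.
Qed.

(** Distinct positive parameters: no two are equal and no product is -1. *)
Definition rank_config (i : O) : R * R := (0, (enum_rank i).+1%:R).

Lemma line_poly (u v : O -> R) :
  exists T : O -> {poly R}, forall i s, (T i).[s] = u i + s * (v i - u i).
Proof. by exists (fun i => (u i)%:P + 'X * (v i - u i)%:P) => i s; rewrite !hornerE. Qed.

Lemma generic_cofin q : cofin (fun s => generic (line q rank_config s)).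
Proof.
pose q1 := rank_config; have [T TE0] := line_poly (fun i => (q i).2) (fun i => (q1 i).2).
have TE i s : (T i).[s] = (line q q1 s i).2 := TE0 i s.
apply: (@cofin_mono _ (fun s => forall i j, (i != j -> (((T j - T i) * (1 + T i * T j)).[s]) != 0))).
  move=> s Ts; apply: generic_cond => i j /Ts; rewrite -!TE.
  by rewrite !(hornerM, hornerD, hornerN, hornerC).
apply: cofin_all => i; apply: cofin_all => j.
have [->|ij] := eqVneq i j; first by exists 1; rewrite ?oner_neq0.
apply: (@cofin_mono _ (fun s => ((T j - T i) * (1 + T i * T j)).[s] != 0)) => //.
apply: (@cofin_poly _ _ 1).
rewrite !(hornerM, hornerD, hornerN, hornerC) !TE line1 /q1 /rank_config /= mulf_neq0 //.
  by rewrite subr_eq0 eqr_nat eqSS; apply: contra ij => /eqP/val_inj/enum_rank_inj->.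
by rewrite gt_eqF // ltr_pwDl ?ltr01 // mulr_ge0 ?ler0n.
Qed.

(** Rigidity becomes injectivity once the trivial motion is pinned at the root [r] and all
    velocities outside [S] are set to zero. *)
Lemma rigid_cofin eps c S L q0 q1 s0 r : r \in S ->
  (forall f, f \in L -> (src f \in S) && (tgt f \in S)) ->
  rigid eps (line q0 q1 s0) c S L ->
  cofin (fun s => rigid eps (line q0 q1 s) c S L).
Proof.
move=> rS LS rig0.
have [T TE0] := line_poly (fun i => (q0 i).2) (fun i => (q1 i).2).
have [Z ZE0] := line_poly (fun i => (q0 i).1) (fun i => (q1 i).1).
have TE i s : (T i).[s] = (line q0 q1 s i).2 := TE0 i s.
have ZE i s : (Z i).[s] = (line q0 q1 s i).1 := ZE0 i s.
(* The coefficients with the nonvanishing denominators [1 + t ^+ 2] of both ends cleared. *)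
pose A f := if tag f == 0%N then (1 + T (src f) ^+ 2) * (1 + T (tgt f) ^+ 2) *
    (Z (src f) - (sg R (gain f))%:P * Z (tgt f)) else (c f).1%:P.
pose B f := if tag f == 0%N then (sg R (gain f))%:P *
    (2%:P * T (src f) * (1 - T (tgt f) ^+ 2) - (1 - T (src f) ^+ 2) * (2%:P * T (tgt f)))
  else (c f).2%:P.
have ABE f s : exists2 n, n != 0 & (A f).[s] = n * (coef (line q0 q1 s) c f).1 /\
    (B f).[s] = n * (coef (line q0 q1 s) c f).2.
  rewrite /A /B /coef; case: ifP => _; last first.
    by exists 1; rewrite ?oner_neq0 // !hornerC !mul1r.
  exists ((1 + (line q0 q1 s (src f)).2 ^+ 2) * (1 + (line q0 q1 s (tgt f)).2 ^+ 2)).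
    by rewrite mulf_neq0 ?circ_den_neq0.
  rewrite !(hornerM, hornerD, hornerN, hornerC, horner_exp) !TE !ZE.
  have := circ_den_neq0 (line q0 q1 s (src f)).2.
  have := circ_den_neq0 (line q0 q1 s (tgt f)).2.
  rewrite /pcoef /hgt /ptx /pty /circx /circy.
  case: (line _ _ _ (src f)) => zi ti; case: (line _ _ _ (tgt f)) => zj tj /= h2 h1.
  by split; field; rewrite ?h1 ?h2.
pose vel w om (j : O * bool) := if j.2 then om j.1 else w j.1.
(* Rows are the edge equations and the pins. Column [(i, true)] is [om i] and [(i, false)] is [w i],
   so [(r, eps)] is the coordinate moved by the trivial motion. *)
pose F (k : 'I_(size L) + O * bool) (j : O * bool) : {poly R} := match k with
  | inl k => let f := tnth (in_tuple L) k in
     let a := if j.2 then B f else A f in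
     (if j.1 == src f then a else 0) -
     (if j.1 == tgt f then (if j.2 then so R eps (gain f) else sw R eps (gain f)) *: a else 0)
  | inr ib => if (ib.1 \notin S) || ((ib.1 == r) && (ib.2 == eps))
      then (if j == ib then 1 else 0) else 0
  end.
have sum_delta (x : O) (a : R) (v : O -> R) : \sum_i (if i == x then a else 0) * v i = a * v x.
  rewrite (bigD1 x) //= eqxx big1 ?addr0 // => i /negPf->.
  by rewrite mul0r.
have Fl s (k : 'I_(size L)) w om : \sum_j (F (inl k) j).[s] * vel w om j =
    let f := tnth (in_tuple L) k in
    (A f).[s] * (w (src f) - liftw eps w (tgt f, gain f)) +
    (B f).[s] * (om (src f) - lifto eps om (tgt f, gain f)).
  have -> : \sum_j (F (inl k) j).[s] * vel w om j =
     \sum_i \sum_b (F (inl k) (i, b)).[s] * vel w om (i, b).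
    by rewrite pair_bigA; apply: eq_bigr => -[].
  under eq_bigr do rewrite big_bool.
  rewrite big_split /= /vel /= addrC /liftw /lifto /=; set f := tnth _ _.
  have part (p : {poly R}) (e : R) (v : O -> R) :
      \sum_i ((if i == src f then p else 0) - (if i == tgt f then e *: p else 0)).[s] * v i
      = p.[s] * (v (src f) - e * v (tgt f)).
    rewrite mulrBr mulrA (mulrC p.[s] e) -!sum_delta -sumrB; apply: eq_bigr => i _.
    by rewrite hornerD hornerN mulrBl; case: ifP => _; case: ifP => _; rewrite ?hornerZ ?horner0.
  by rewrite !part.
have Fr s ib m : ((ib.1 \notin S) || ((ib.1 == r) && (ib.2 == eps))) ->
    \sum_j (F (inr ib) j).[s] * m j = m ib.
  move=> /= ->; rewrite (bigD1 ib) //= eqxx hornerC mul1r big1 ?addr0 // => j /negPf->.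
  by rewrite horner0 mul0r.
have Fflex s m : (forall k, \sum_j (F k j).[s] * m j = 0) <->
    flex eps (line q0 q1 s) c L (fun i => m (i, false)) (fun i => m (i, true)) /\
    (forall ib, (ib.1 \notin S) || ((ib.1 == r) && (ib.2 == eps)) -> m ib = 0).
  have mE : m = vel (fun i => m (i, false)) (fun i => m (i, true)).
    by apply/funext => -[i []].
  have rowE f : (A f).[s] * (m (src f, false) - liftw eps (fun i => m (i, false)) (tgt f, gain f)) +
    (B f).[s] * (m (src f, true) - lifto eps (fun i => m (i, true)) (tgt f, gain f)) = 0 <->
    eqn eps (coef (line q0 q1 s) c f) f (fun i => m (i, false)) (fun i => m (i, true)) = 0.
    have [n n0 [-> ->]] := ABE f s; rewrite -!mulrA -mulrDr.
    split=> [/eqP|e0]; first by rewrite mulf_eq0 (negPf n0) => /eqP.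
    by rewrite -[RHS](mulr0 n); congr (n * _).
  split=> [mk|[mf m0] [k|ib]].
  - split=> [f /seq_tnthP[k fk]|ib ibP]; last by rewrite -(Fr s _ _ ibP) mk.
    by apply/rowE; rewrite fk; have := mk (inl k); rewrite [in X in X -> _]mE Fl.
  - by rewrite mE Fl; apply/rowE; apply: mf; apply: mem_tnth.
  - case ibP : ((ib.1 \notin S) || ((ib.1 == r) && (ib.2 == eps))); first by rewrite Fr // m0.
    by rewrite big1 // => j _; rewrite /F ibP horner0 mul0r.
have cofF := @cofin_injective _ _ _ F s0.
apply: (cofin_mono _ (cofF _)); last first.
  move=> m /Fflex[/rig0[a [b ab]] m0].
  have [sw1 so1] : (liftw eps (fun i => m (i, false)) (r, true) = a) /\ _ := ab r true rS.
  have [sw0 so0] := ab r false rS.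
  have := m0 (r, eps); rewrite !eqxx orbT => /(_ isT) mr.
  have [a0 b0] : a = 0 /\ b = 0.
    move: sw1 so1 sw0 so0 mr; rewrite /liftw /lifto /sw /so /sg /=.
    by case: (eps) => /=; lra.
  move=> [i b']; have [iS|niS] := boolP (i \in S); last by apply: m0; rewrite niS.
  have := ab i false iS; rewrite a0 b0 /liftw /lifto /sw /so /sg !andbF !mul1r /=.
  by case: b' => -[].
move=> s inj w om wom.
(* Subtracting the trivial motion that agrees with the flex at [r] makes it satisfy the pins. *)
pose kw := if eps then 0 else w r; pose ko := if eps then om r else 0.
pose m (j : O * bool) := if j.1 \in S then (if j.2 then om j.1 - ko else w j.1 - kw) else 0.
have m0 : m =1 fun=> 0.
  apply: inj; apply/Fflex; split=> [f fL|[i b]] /=; last first.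
    rewrite /m /=; case: ifP => //= _ /andP[/eqP-> /eqP->].
    by rewrite /kw /ko; case: (eps); rewrite subrr.
  have /andP[sS tS] := LS f fL; rewrite -[RHS](wom f fL) /eqn /eqrow /liftw /lifto /m /= sS tS.
  rewrite /kw /ko /sw /so /sg; case: (eps); case: gain => /=; ring.
exists kw, ko => i b iS; have := m0 (i, false); have := m0 (i, true).
rewrite /m /= iS /liftw /lifto /kw /ko /sw /so /sg /=.
by case: (eps); case: b => /=; split; lra.
Qed.

Lemma rigid_generic eps q c S L r : r \in S ->
  (forall f, f \in L -> (src f \in S) && (tgt f \in S)) ->
  rigid eps q c S L -> exists2 q', generic q' & rigid eps q' c S L.
Proof.
move=> rS LS rig; have := @rigid_cofin eps c S L q rank_config 0 r rS LS; rewrite line0 => /(_ rig) c1.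
have [s [? ?]] := cofin_ex (cofin_and (generic_cofin q) c1).
by exists (line q rank_config s).
Qed.

End Genericity.

(** * Induction on the number of orbits *)

Section Induction.
Variables (R : realFieldType) (O : finType).
Implicit Types (q : O -> R * R) (c : gedge O -> R * R) (w om : O -> R) (f : gedge O)
  (S : {set O}) (L : seq (gedge O)) (o r : O) (eps : bool).

Lemma sum_degree L o : (\sum_(f <- L) ((src f == o) + (tgt f == o)) =
  size (filter (incident o) L) + count (fun f => incident o f && loop f) L)%N.
Proof.
elim: L => [|f L IH]; first by rewrite big_nil.
rewrite big_cons IH /= /incident /loop.
case: eqP => [->|so] /=; last first.
  by case: (tgt f =P o) => [->|_] /=; rewrite ?(introF eqP so); lia.
by rewrite eq_sym; case: eqP => /= _; lia.
Qed.

Lemma size_rest_incident L o : (size (rest o L) + size (filter (incident o) L) = size L)%N.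
Proof. by rewrite !size_filter -(count_predC (incident o)) addnC. Qed.

Lemma far_in S L o f : wf S L -> f \in L -> incident o f -> ~~ loop f -> (far o f).1 \in S :\ o.
Proof.
case=> _ inS _ _ _ /inS/andP[sS tS]; rewrite /incident /loop /far !inE /=.
case: eqP => [->|/eqP so] /=; first by rewrite eq_sym => _ ->.
by rewrite so sS.
Qed.

Lemma far_inj S L o f f' : wf S L -> f \in L -> f' \in L -> incident o f -> incident o f' ->
  tag f = 0%N -> tag f' = 0%N -> far o f = far o f' -> f = f'.
Proof.
case=> _ _ simL _ _ fL f'L; have := simL f fL.
case: f f' fL f'L => [k [[i j] g]] [k' [[i' j'] g']] fL f'L.
rewrite /incident /far /tag /src /tgt /gain /loop /= => sim fo f'o k0 k0'.
move: sim fo f'o; rewrite k0 in fL *; rewrite k0' in f'L * => /(_ erefl)/andP[ij nL].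
case: (i =P o) => [io|_]; case: (i' =P o) => [io'|_] /=.
- by move=> _ _ [-> ->]; rewrite io io'.
- by move=> _ /eqP jo' [ji gg]; move: nL; rewrite ji gg io -jo' f'L.
- by move=> /eqP jo _ [ij' gg]; move: nL; rewrite ij' gg jo -io' f'L.
- by move=> /eqP-> /eqP-> [-> ->].
Qed.

Lemma flex_rest eps q c q' c' L o w om :
  (forall f, ~~ incident o f -> coef q' c' f = coef q c f) ->
  flex eps q' c' L w om -> flex eps q c (rest o L) w om.
Proof.
by move=> cE wom f; rewrite mem_filter => /andP[fo /wom]; rewrite cE.
Qed.

Lemma const_on_far eps S w om A B y :
  const_on eps S w om A B -> y.1 \in S -> liftw eps w y = A /\ lifto eps om y = B.
Proof. by case: y => i b /= cs iS; apply: cs. Qed.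

(** The orbit [i] already forces the odd one of [A] and [B] to be 0, which makes the values at [o]
    agree on both sheets. *)
Lemma const_on_add eps S o w om A B i : i \in S :\ o -> const_on eps (S :\ o) w om A B ->
  w o = A -> om o = B -> const_on eps S w om A B.
Proof.
move=> iS cAB wA oB j b jS; have [->|jo] := eqVneq j o; last by apply: cAB; rewrite !inE jo.
have [h1 h2] := cAB i true iS; have [h3 h4] := cAB i false iS.
move: h1 h2 h3 h4; rewrite /liftw /lifto /sw /so /sg /= wA oB.
by case: (eps) => /=; case: (b) => /=; split; lra.
Qed.

(** A flex is constant on the rest, so the two edges give a square system for the deviations of
    [w o] and [om o] from the constants. *)
Lemma rigid_add_two eps S L o q c f1 f2 i : wf S L -> o \in S -> i \in S :\ o -> generic q ->
  rigid eps q c (S :\ o) (rest o L) -> f1 \in L -> f2 \in L -> f1 != f2 ->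
  incident o f1 && ~~ loop f1 -> incident o f2 && ~~ loop f2 ->
  exists q' c', rigid eps q' c' S L.
Proof.
move=> wfL oS iS gq rig f1L f2L f12 /andP[i1 l1] /andP[i2 l2].
have [|P [P1 P2 P3]] := @fresh_points R O q (far o) [:: f1; f2] gq.
  have inc f : f \in [:: f1; f2] -> f \in L /\ incident o f.
    by rewrite !inE => /orP[] /eqP->.
  by move=> f f' /inc[fL fo] /inc[f'L f'o] t0 t0'; apply: (far_inj wfL).
pose h f := if tag f == 0%N then hgt q (far o f) else 0.
have P12 : ((P f1).1, (P f1).2) != ((P f2).1, (P f2).2).
  rewrite -!surjective_pairing; apply: contraNneq f12 => /P3->; rewrite // !inE eqxx ?orbT //.
have [z [t zt]] := @generic_two_rows R (h f1) _ _ (h f2) _ _ P12.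
have [|q' [c' [ext0 _ ext]]] := @extend R O eps q c o z t h P.
  by move=> f fo fl t0; rewrite /h t0 eqxx P1.
exists q', c' => w om wom.
have [A [B cAB]] := rig _ _ (flex_rest ext0 wom).
exists A, B; have rowf f : f \in L -> incident o f -> ~~ loop f ->
    (z - h f) * (w o - A) + (circy t * (P f).1 - circx t * (P f).2) * (om o - B) = 0.
  move=> fL fo fl; have := ext f w om fo fl (wom f fL).
  by have [<- <-] := const_on_far cAB (far_in wfL fL fo fl).
have [wA oB] := zt _ _ (rowf _ f1L i1 l1) (rowf _ f2L i2 l2).
by apply: (const_on_add iS cAB); lra.
Qed.

(** A loop of gain [false] would lift to loops at single vertices, which sparsity forbids. *)
Lemma loop_free_gain S L f : wf S L -> f \in L -> loop f -> tag f != 0%N /\ gain f = true.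
Proof.
case=> _ _ simL sL _ fL lf; split; first by apply/eqP => /(simL f fL); rewrite lf.
apply/negP => /negP/negbTE gf.
have /sL : [set (src f, false)] != set0 by apply/set0Pn; exists (src f, false); rewrite set11.
move: lf; rewrite /loop => /eqP lf.
rewrite cards1 /cnt (perm_big _ (perm_to_rem fL)) big_cons /cnt1 -lf gf !inE eqxx /=.
lia.
Qed.

(** With coefficients [(1, 1)] and gain [true] the loop kills the odd one of [w o] and [om o]; the
    other edge determines the remaining one. *)
Lemma rigid_add_loop eps S L o q c f1 f2 i : wf S L -> o \in S -> i \in S :\ o ->
  rigid eps q c (S :\ o) (rest o L) -> f1 \in L -> f2 \in L ->
  incident o f1 && loop f1 -> incident o f2 && ~~ loop f2 ->
  exists q' c', rigid eps q' c' S L.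
Proof.
move=> wfL oS iS rig f1L f2L /andP[i1 l1] /andP[i2 l2].
pose P f := if tag f == 0%N then (ptx q (far o f), pty q (far o f)) else (1, 0).
pose h f := if tag f == 0%N then hgt q (far o f) else 0.
have P2 : (P f2).1 ^+ 2 + (P f2).2 ^+ 2 = 1.
  by rewrite /P; case: ifP => _; rewrite /= ?pt_unit // expr1n expr0n addr0.
have [z [t [z0 t0]]] := @generic_row R (h f2) _ _ P2.
have [|q' [c' [ext0 extl ext]]] := @extend R O eps q c o z t h P.
  by move=> f fo fl t0'; rewrite /h /P t0' eqxx.
exists q', c' => w om wom.
have [A [B cAB]] := rig _ _ (flex_rest ext0 wom).
have row2 : (z - h f2) * (w o - A) + (circy t * (P f2).1 - circx t * (P f2).2) * (om o - B) = 0.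
  have := ext f2 w om i2 l2 (wom f2 f2L).
  by have [<- <-] := const_on_far cAB (far_in wfL f2L i2 l2).
have [tf gf] := loop_free_gain wfL f1L l1.
have sf : src f1 = o by move: i1 l1; rewrite /incident /loop => /orP[] /eqP-> // /eqP.
have := wom f1 f1L; rewrite extl // /eqn /eqrow -(eqP l1) sf gf /liftw /lifto /=.
have [h1 h2] := cAB i true iS; have [h3 h4] := cAB i false iS.
move=> row1; exists A, B; suff [wA oB] : w o = A /\ om o = B by apply: (const_on_add iS cAB).
have nz (u v : R) : u != 0 -> u * v = 0 -> v = 0.
  by move=> u0 /eqP; rewrite mulf_eq0 (negPf u0) => /eqP.
move: h1 h2 h3 h4 row1 row2; rewrite /liftw /lifto /sw /so /sg /=.
case: (eps) => /= h1 h2 h3 h4 row1 row2.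
  have wA : w o - A = 0 by lra.
  by move: row2; rewrite wA mulr0 add0r => /(nz _ _ t0); lra.
have oB : om o - B = 0 by lra.
by move: row2; rewrite oB mulr0 addr0 => /(nz _ _ z0); lra.
Qed.

Definition join k (y y' : O * bool) : gedge O := (k, (y.1, y'.1, y.2 (+) y'.2)).

Lemma eqn_join eps a k y y' w om :
  liftw eps w y = liftw eps w y' -> lifto eps om y = lifto eps om y' ->
  eqn eps a (join k y y') w om = 0.
Proof.
case: y y' => [i b] [j b']; rewrite /eqn /eqrow /join /src /tgt /gain /liftw /lifto /=.
move=> hw ho; suff [-> ->] : w i = sw R eps (b (+) b') * w j /\ om i = so R eps (b (+) b') * om j.
  by rewrite !subrr !mulr0 addr0.
move: hw ho; rewrite /sw /so /sg.
by case: (eps); case: (b); case: (b') => /=; split; lra.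
Qed.

(* [(W, Om)] is, up to a constant, the only nontrivial flex that may appear when
   the equation of [join k y y'] is dropped. *)
Lemma flex_without_join eps S L q c k y y' : y != y' ->
  rigid eps q c S (join k y y' :: L) ->
  exists W Om : O * bool -> R, ~ (W y = W y' /\ Om y = Om y') /\
    forall w om, flex eps q c L w om -> exists cc A B, forall z, z.1 \in S ->
      liftw eps w z = cc * W z + A /\ lifto eps om z = cc * Om z + B.
Proof.
move=> yy' rig; set f0 := join k y y'; pose e := eqn eps (coef q c f0) f0.
have rig0 w om : flex eps q c L w om -> e w om = 0 -> exists A B, const_on eps S w om A B.
  by move=> fl e0; apply: rig => f; rewrite in_cons => /predU1P[->|/fl].
case: (pselect (forall w om, flex eps q c L w om -> e w om = 0)) => [all0|].
  (* The dropped equation was redundant, so any pair separating [y] from [y'] serves, with factor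
     0. *)
  exists (fun z => (z == y)%:R), (fun=> 0); split.
    by rewrite eqxx eq_sym (negPf yy') => -[/eqP]; rewrite oner_eq0.
  move=> w om fl; have [A [B cAB]] := rig0 _ _ fl (all0 _ _ fl).
  by exists 0, A, B => z zS; rewrite !mul0r !add0r; apply: const_on_far cAB zS.
move/existsNP=> [w0 /existsNP[om0 /not_implyP[fl0 /eqP e0]]].
exists (liftw eps w0), (lifto eps om0); split.
  by move=> [hw ho]; rewrite /e eqn_join ?eqxx in e0.
(* This multiple cancels the residual of the dropped equation. *)
move=> w om fl; pose cc := e w om / e w0 om0.
pose w1 i := w i - cc * w0 i; pose om1 i := om i - cc * om0 i.
have lin f a : eqn eps a f w1 om1 = eqn eps a f w om - cc * eqn eps a f w0 om0.
  by rewrite /eqn /eqrow /liftw /lifto /w1 /om1; ring.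
have [|| A [B cAB]] := rig0 w1 om1.
- by move=> f fL; rewrite lin fl // fl0 // mulr0 subr0.
- by rewrite /e lin -/(e _ _) -/(e _ _) /cc divfK // subrr.
exists cc, A, B => z zS; have [<- <-] := const_on_far cAB zS.
by rewrite /liftw /lifto /w1 /om1; split; ring.
Qed.

(** Three equations determine the deviations of [w o] and [om o] and the amplitude [cc] of the extra
    flex, which separates [y] from [y'] and so is not constant on the far ends. *)
Lemma rigid_add_three eps S L o q c f1 f2 f3 k y y' i :
  wf S L -> o \in S -> i \in S :\ o -> generic q ->
  uniq [:: f1; f2; f3] -> {in [:: f1; f2; f3], forall f, [&& f \in L, incident o f & ~~ loop f]} ->
  y \in map (far o) [:: f1; f2; f3] -> y' \in map (far o) [:: f1; f2; f3] -> y != y' ->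
  rigid eps q c (S :\ o) (join k y y' :: rest o L) ->
  exists q' c', rigid eps q' c' S L.
Proof.
move=> wfL oS iS gq uf inf yf yf' yy' /(flex_without_join yy')[W [Om [ne fl]]].
have [|P [P1 P2 P3]] := @fresh_points R O q (far o) [:: f1; f2; f3] gq.
  by move=> f f' /inf/and3P[fL fo _] /inf/and3P[f'L f'o _] t0 t0'; apply: (far_inj wfL).
pose h f := if tag f == 0%N then hgt q (far o f) else 0.
have Pn f f' : f \in [:: f1; f2; f3] -> f' \in [:: f1; f2; f3] -> f != f' ->
    ((P f).1, (P f).2) != ((P f').1, (P f').2).
  by move=> fi f'i; rewrite -!surjective_pairing; apply: contraNneq => /P3->.
have [m1 m2 m3] : [/\ f1 \in [:: f1; f2; f3], f2 \in [:: f1; f2; f3] & f3 \in [:: f1; f2; f3]].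
  by rewrite !inE !eqxx !orbT.
have [n12 n13 n23] : [/\ f1 != f2, f1 != f3 & f2 != f3].
  by move: uf; rewrite /= !inE negb_or !andbT => /andP[/andP[-> ->] ->].
have [|z [t zt]] := @generic_three_rows R (h f1) _ _ (h f2) _ _ (h f3) _ _
  (W (far o f1)) (W (far o f2)) (W (far o f3)) (Om (far o f1)) (Om (far o f2)) (Om (far o f3))
  (P2 f1) (P2 f2) (P2 f3) (Pn _ _ m1 m2 n12) (Pn _ _ m1 m3 n13) (Pn _ _ m2 m3 n23).
  move=> [w12 w23 o12 o23]; apply: ne.
  by move: yf yf'; rewrite !inE => /or3P[]/eqP-> /or3P[]/eqP->;
    rewrite ?w12 ?w23 ?o12 ?o23.
have [|q' [c' [ext0 _ ext]]] := @extend R O eps q c o z t h P.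
  by move=> f fo fl0 t0; rewrite /h t0 eqxx P1.
exists q', c' => w om wom.
have [cc [A [B ccAB]]] := fl _ _ (flex_rest ext0 wom).
have rowf f : f \in [:: f1; f2; f3] -> (z - h f) * ((w o - A) - cc * W (far o f)) +
    (circy t * (P f).1 - circx t * (P f).2) * ((om o - B) - cc * Om (far o f)) = 0.
  move=> /inf/and3P[fL fo flo]; rewrite -[RHS](ext f w om fo flo (wom f fL)) /eqrow.
  by have [-> ->] := ccAB _ (far_in wfL fL fo flo); congr (_ * _ + _ * _); ring.
have [wA oB cc0] := zt _ _ _ (rowf _ m1) (rowf _ m2) (rowf _ m3).
exists A, B; apply: (const_on_add iS); try lra.
by move=> j b jS; have [-> ->] := ccAB (j, b) jS; rewrite cc0 !mul0r !add0r.
Qed.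

Theorem gain_rigid eps S L : wf S L -> exists q c, rigid eps q c S L.
Proof.
have [n] := ubnP #|S|; elim: n S L => // n IH S L Sn wfL.
have [o oS deg] := exists_low_degree wfL.
have [S1|S1] := leqP #|S| 1.
  have SE : S = [set o].
    by apply/esym/eqP; rewrite eqEcard sub1set oS cards1.
  (* A single orbit carries exactly one edge, necessarily a free loop of gain [true]. *)
  have [f LE] : exists f, L = [:: f].
    by case: wfL => _ _ _ _; rewrite SE cards1; case: (L) => [|f [|]] //; exists f.
  have fL : f \in L by rewrite LE inE.
  have [sf tf] : src f = o /\ tgt f = o.
    by case: wfL => _ /(_ f fL); rewrite SE !inE => /andP[/eqP-> /eqP->].
  have lf : loop f by rewrite /loop sf tf.
  have [tf0 gf] := loop_free_gain wfL fL lf.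
  exists (fun=> (0, 0)), (fun=> (1, 1)) => w om /(_ f fL).
  rewrite /coef (negPf tf0) /eqn /eqrow /liftw /lifto sf tf gf /sw /so /sg.
  case: (eps) => /= row0.
    exists 0, (om o) => i b; rewrite SE inE => /eqP->; rewrite /liftw /lifto /sw /so /sg /=.
    by case: (b); split; lra.
  exists (w o), 0 => i b; rewrite SE inE => /eqP->; rewrite /liftw /lifto /sw /so /sg /=.
  by case: (b); split; lra.
have [i iS] : exists i, i \in S :\ o.
  by apply/set0Pn; rewrite -card_gt0; move: S1; rewrite (cardsD1 o S) oS.
have So : (#|S :\ o| < n)%N by move: Sn; rewrite (cardsD1 o S) oS.
have szr := size_rest wfL oS S1; have szi := size_rest_incident L o.
rewrite sum_degree in deg.
have uI : uniq (filter (incident o) L) by apply: filter_uniq; case: wfL.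
have inI f : f \in filter (incident o) L -> f \in L /\ incident o f.
  by rewrite mem_filter => /andP[].
have cntI : count (fun f => incident o f && loop f) L =
    count (@loop O) (filter (incident o) L).
  by rewrite count_filter; apply: eq_count => f /=; rewrite andbC.
have re := wf_rest_ends (o := o) wfL.
rewrite cntI in deg.
case EI : (filter (incident o) L) szi uI inI deg {cntI} => [|f1 [|f2 [|f3 [|f4 I]]]] szi uI inI deg;
  rewrite /= in szi deg.
- by move: szr szi; lia.
- by move: szr szi; lia.
- have wfL' : wf (S :\ o) (rest o L) by apply: wf_rest => //; lia.
  have [q1 [c rig1]] := IH _ _ So wfL'.
  have [q gq rig] := rigid_generic iS re rig1.
  have [[f1L f1o] [f2L f2o]] : (f1 \in L /\ incident o f1) /\ (f2 \in L /\ incident o f2).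
    by split; apply: inI; rewrite !inE eqxx ?orbT.
  have f12 : f1 != f2 by move: uI; rewrite /= inE andbT.
  have [l1|l1] := boolP (loop f1).
    have [l2|l2] := boolP (loop f2); first by move: deg; rewrite l1 l2.
    apply: (rigid_add_loop wfL oS iS rig f1L f2L); first by rewrite f1o l1.
    by rewrite f2o l2.
  have [l2|l2] := boolP (loop f2).
    apply: (rigid_add_loop wfL oS iS rig f2L f1L); first by rewrite f2o l2.
    by rewrite f1o l1.
  by apply: (rigid_add_two wfL oS iS gq rig f1L f2L f12); rewrite ?f1o ?f2o.
- have l0 f : f \in [:: f1; f2; f3] -> ~~ loop f.
    have : ~~ has (@loop O) [:: f1; f2; f3] by rewrite has_count /= ; move: deg; lia.
    by move=> /hasPn; apply.
  have inf : {in [:: f1; f2; f3], forall f, [&& f \in L, incident o f & ~~ loop f]}.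
    by move=> f fi; have [-> ->] := inI f fi; rewrite l0.
  pose k := (\max_(f <- L) tag f).+1.
  have kL : {in L, forall f, tag f != k}.
    by move=> f fL; rewrite /k neq_ltn ltnS (@leq_bigmax_seq _ _ xpredT (@tag O)).
  have far3 y : y \in map (far o) [:: f1; f2; f3] -> y.1 \in S :\ o.
    by case/mapP => f /inf/and3P[fL fo fl] ->; apply: (far_in wfL).
  have [y [y' [yf yf' nb]]] : exists y y', [/\ y \in map (far o) [:: f1; f2; f3],
      y' \in map (far o) [:: f1; f2; f3] & ~ bonded (rest o L) y y'].
    (* If the far ends of [f1] and [f2] are bonded, those of [f2] and [f3] are not. *)
    have [b12|nb12] := pselect (bonded (rest o L) (far o f1) (far o f2)).
      exists (far o f2), (far o f3); rewrite !inE !eqxx !orbT; split=> //.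
      have sub : sparse [:: f1, f2, f3 & rest o L].
        case: wfL => _ _ _ sL _ X /sL; rewrite (cnt_filter (incident o) L X) EI.
        by rewrite -cnt_cat.
      apply: (far_not_bonded sub) b12 => f; first by rewrite mem_filter => /andP[].
      by move=> /inf/and3P[_ -> ->].
    by exists (far o f1), (far o f2); rewrite !inE !eqxx !orbT.
  have yy' : y != y'.
    apply/eqP => yy'; apply: nb; rewrite yy'; apply: bonded_refl; apply: sparse_filter.
    by case: wfL.
  have wfL' : wf (S :\ o) (join k y y' :: rest o L).
    by apply: wf_rest_add; rewrite ?far3 //; lia.
  have [q1 [c rig1]] := IH _ _ So wfL'.
  have [|q gq rig] := rigid_generic iS _ rig1; first by case: wfL'.
  exact: (rigid_add_three wfL oS iS gq uI inf yf yf' yy' rig).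
by move: szr szi deg; lia.
Qed.

End Induction.

(** * The rigidity matrix *)

Section RigidityMatrix.
Variables (R : realFieldType) (V : finType) (e : rel V).
Implicit Types (p : V -> 'rV[R]_3) (r : (edge_of e + V)%type) (g : (V * 'I_3)%type -> R)
  (f : edge_of e).

Lemma edge_neq f : (val f).1 != (val f).2.
Proof. by have /andP[_] := valP f; apply: contraTneq => ->; rewrite ltnn. Qed.

Lemma sum_rig_entry p r g : \sum_c rig_entry p r c * g c =
  match r with
  | inl f => \sum_k (p (val f).1 - p (val f).2) 0 k * (g ((val f).1, k) - g ((val f).2, k))
  | inr v => p v 0 0 * g (v, 0) + p v 0 1 * g (v, 1)
  end.
Proof.
have -> : \sum_c rig_entry p r c * g c = \sum_v \sum_k rig_entry p r (v, k) * g (v, k).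
  by rewrite pair_bigA; apply: eq_bigr => -[].
case: r => [f|v]; last first.
  rewrite (bigD1 v) //= eqxx [X in _ + X]big1 ?addr0 => [|w /negPf wv].
    by rewrite !big_ord_recl big_ord0 !mxE /= mul0r !addr0; congr (_ * g (_, _) + _ * g (_, _)); apply: val_inj.
  by apply: big1 => k _; rewrite /= wv mul0r.
have uv := edge_neq f; rewrite /rig_entry; set a := (val f).1; set b := (val f).2.
rewrite (bigD1 a) //= eqxx (bigD1 b) //= 1?eq_sym // (negPf uv) eqxx.
rewrite [X in _ + (_ + X)]big1 ?addr0 => [|w /andP[/negPf wa /negPf wb]].
  rewrite -big_split /=; apply: eq_bigr => k _.
  by rewrite !mxE; ring.
by apply: big1 => k _; rewrite wa wb mul0r.
Qed.

Lemma sum_enum_val (I : finType) (F : I -> R) : \sum_(j < #|I|) F (enum_val j) = \sum_i F i.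
Proof. by rewrite [RHS](reindex _ (onW_bij _ (@enum_val_bij I))). Qed.

Lemma mul_rigidity p n (u : 'M[R]_(#|{: (V * 'I_3)%type}|, n)) r j :
  (rigidity_matrix e p *m u) (enum_rank r) j = \sum_c rig_entry p r c * u (enum_rank c) j.
Proof.
rewrite mxE -[RHS]sum_enum_val; apply: eq_bigr => i _.
by rewrite !mxE enum_rankK enum_valK.
Qed.

(** Row 0 is the translation along the axis, row 1 the rotation about it. *)
Definition trivial_motions p : 'M[R]_(2, #|{: (V * 'I_3)%type}|) :=
  \matrix_(l, j) let c := enum_val j in
    if l == 0 then vec3 0 0 1 0 c.2 else vec3 (- p c.1 0 1) (p c.1 0 0) 0 0 c.2.

Lemma sum3 (F : 'I_3 -> R) : \sum_k F k = F 0 + F 1 + F 2%:R.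
Proof.
rewrite !big_ord_recl big_ord0 addr0 addrA; congr (F _ + F _ + F _); exact: val_inj.
Qed.

Lemma vec3E (x y z : R) : [/\ vec3 x y z 0 0 = x, vec3 x y z 0 1 = y & vec3 x y z 0 2%:R = z].
Proof. by rewrite !mxE. Qed.

Lemma rigidity_trivial p : rigidity_matrix e p *m (trivial_motions p)^T = 0.
Proof.
apply/matrixP => i l; rewrite -[i]enum_valK mul_rigidity sum_rig_entry [RHS]mxE.
case: (enum_val i) => [f|v].
  rewrite sum3 !mxE !enum_rankK /=.
  by case: (l == 0); rewrite !mxE /=; ring.
rewrite !mxE !enum_rankK /=.
by case: (l == 0); rewrite !mxE /=; ring.
Qed.

Lemma trivial_free p n (ci : 'I_n -> 'I_#|{: (V * 'I_3)%type}|) v : on_cylinder (p v) ->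
  (forall k, exists j, ci j = enum_rank (v, k)) -> row_free (colsub ci (trivial_motions p)).
Proof.
move=> pv vC; set N := (X in row_free X).
rewrite -kermx_eq0; apply/eqP/row_matrixP => i; rewrite row0; set u := row i _.
have uN : u *m N = 0 by rewrite -row_mul mulmx_ker row0.
have colE k : u 0 0 * vec3 0 0 1 0 k + u 0 1 * vec3 (- p v 0 1) (p v 0 0) 0 0 k = 0.
  have [j jE] := vC k.
  have NE l : N l j = if l == 0 then vec3 0 0 1 0 k else vec3 (- p v 0 1) (p v 0 0) 0 0 k.
    by rewrite mxE mxE jE enum_rankK.
  have := congr1 (fun A : 'rV_n => A 0 j) uN.
  rewrite mxE [RHS]mxE !big_ord_recl big_ord0 addr0 !NE /= => h; rewrite -[RHS]h.
  by have -> : lift ord0 ord0 = 1 :> 'I_2 by apply: val_inj.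
have [t0 t1 t2] := vec3E (0 : R) 0 1; have [s0 s1 s2] := vec3E (- p v 0 1) (p v 0 0) 0.
have := colE 0; have := colE 1; have := colE 2%:R; rewrite t0 t1 t2 s0 s1 s2 => e2 e1 e0.
have u0 : u 0 0 = 0 by lra.
have u1 : u 0 1 = 0.
  apply/eqP; rewrite -sqrf_eq0; apply/eqP.
  transitivity ((u 0 1 * p v 0 0) ^+ 2 + (u 0 1 * p v 0 1) ^+ 2).
    by rewrite !exprMn -mulrDr pv mulr1.
  have -> : u 0 1 * p v 0 0 = 0 by lra.
  have -> : u 0 1 * p v 0 1 = 0 by lra.
  by rewrite expr0n addr0.
apply/rowP => l; rewrite [RHS]mxE.
by case: l => [[|[|l]] //= ll]; [rewrite -[RHS]u0 | rewrite -[RHS]u1]; congr (u _ _); apply: val_inj.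
Qed.

Definition kernel_trivial p := forall u : 'cV[R]_(#|{: (V * 'I_3)%type}|),
    rigidity_matrix e p *m u = 0 ->
    exists a b : R, forall (w : V) (k : 'I_3),
      u (enum_rank (w, k)) 0 = vec3 (- b * p w 0 1) (b * p w 0 0) a 0 k.

Lemma ker_trivial p : kernel_trivial p ->
  (kermx (rigidity_matrix e p)^T <= trivial_motions p)%MS.
Proof.
move=> ker; apply/row_subP => i; set u := row i _.
have [|a [b uab]] := ker u^T.
  by apply: trmx_inj; rewrite trmx_mul trmxK -row_mul mulmx_ker row0 trmx0.
have -> : u = (\row_(l < 2) if l == 0 then a else b) *m trivial_motions p.
  apply/rowP => j; have := uab (enum_val j).1 (enum_val j).2.
  rewrite -surjective_pairing enum_valK mxE => ->.
  rewrite [RHS]mxE !big_ord_recl big_ord0 addr0 !mxE /=.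
  by case: (enum_val j).2 => [[|[|[|k]]] //= kk]; rewrite !mxE /=; ring.
exact: submxMl.
Qed.

Lemma card_rows : #|{: (edge_of e + V)%type}| = (#|{: edge_of e}| + #|V|)%N.
Proof. exact: card_sum. Qed.

Lemma card_cols : #|{: (V * 'I_3)%type}| = (3 * #|V|)%N.
Proof. by rewrite card_prod card_ord mulnC. Qed.

Lemma rank_ge p : kernel_trivial p -> (3 * #|V| <= \rank (rigidity_matrix e p) + 2)%N.
Proof.
move/ker_trivial/mxrankS; rewrite mxrank_ker mxrank_tr => h.
by rewrite -card_cols -leq_subLR (leq_trans h) // rank_leq_row.
Qed.

(** The rows of [E'] and [V'] vanish outside the columns of [V'], so they stay independent when
    restricted there; two trivial motions remain in the kernel, whence
    [#|E'| + #|V'| <= 3 * #|V'| - 2]. *)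
Lemma row_free_sparse p (V' : {set V}) (E' : {set edge_of e}) :
  (forall v, on_cylinder (p v)) -> row_free (rigidity_matrix e p) -> V' != set0 ->
  (forall f, f \in E' -> ((val f).1 \in V') && ((val f).2 \in V')) ->
  (#|E'| + 2 <= 2 * #|V'|)%N.
Proof.
move=> pY /row_freeP[B MB] /set0Pn[v vV'] E'V'.
pose I := [set r : edge_of e + V | match r with inl f => f \in E' | inr v => v \in V' end].
pose C := [set c : V * 'I_3 | c.1 \in V'].
pose ri (i : 'I_#|I|) := enum_rank (enum_val i).
pose ci (j : 'I_#|C|) := enum_rank (enum_val j).
have ri_inj : injective ri by move=> i j /enum_rank_inj/enum_val_inj.
pose N := rowsub ri (rigidity_matrix e p).
have NB : N *m colsub ri B = 1%:M.
  rewrite -mxsub_mul MB; apply/matrixP => i j; rewrite !mxE.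
  by rewrite (inj_eq ri_inj).
have N0 i c : c \notin C -> N i (enum_rank c) = 0.
  rewrite inE !mxE !enum_rankK => cV'; have := enum_valP i; rewrite inE.
  case: (enum_val i) => [f /E'V'/andP[f1 f2]|w wV'] /=.
    by rewrite !ifN //; apply: contraNneq cV' => ->.
  by rewrite ifN //; apply: contraNneq cV' => ->.
have sumC n (X : 'M[R]_(#|{: (V * 'I_3)%type}|, n)) : N *m X = colsub ci N *m rowsub ci X.
  apply/matrixP => i l; rewrite [LHS]mxE [RHS]mxE.
  pose F c := N i (enum_rank c) * X (enum_rank c) l.
  transitivity (\sum_c F c).
    by rewrite -[RHS]sum_enum_val; apply: eq_bigr => j _; rewrite /F enum_valK.
  rewrite (bigID (mem C)) /= [X in _ + X]big1 ?addr0 => [|c cC]; last by rewrite /F N0 ?mul0r.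
  rewrite big_enum_val; apply: eq_bigr => j _.
  by rewrite /F ![in RHS]mxE ![in LHS]mxE.
have rN : \rank (colsub ci N) = #|I|.
  apply/eqP; change (row_free (colsub ci N)); apply/row_freeP.
  by exists (rowsub ci (colsub ri B)); rewrite -sumC.
have NT : colsub ci N *m (colsub ci (trivial_motions p))^T = 0.
  have -> : (colsub ci (trivial_motions p))^T = rowsub ci (trivial_motions p)^T.
    by apply/matrixP => i j; rewrite !mxE.
  rewrite -sumC /N mul_rowsub_mx rigidity_trivial.
  by apply/matrixP => i j; rewrite !mxE.
have := mulmx0_rank_max NT; rewrite rN mxrank_tr.
have /eqP -> : row_free (colsub ci (trivial_motions p)).
  apply: (trivial_free (v := v)) => // k; have vkC : (v, k) \in C by rewrite inE.
  by exists (enum_rank_in vkC (v, k)); rewrite /ci enum_rankK_in.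
have -> : #|I| = (#|E'| + #|V'|)%N.
  rewrite -[#|E'|](card_imset _ (@inl_inj _ V)) -[#|V'|](card_imset _ (@inr_inj (edge_of e) _)).
  rewrite -cardsUI [_ :&: _](_ : _ = set0) ?cards0 ?addn0; last first.
    by apply/setP => r; rewrite !inE; apply/negP => /andP[/imsetP[f _ ->] /imsetP[]].
  apply: eq_card => -[f|w]; rewrite !inE.
    by rewrite (mem_imset _ _ inl_inj) [X in _ || X](_ : _ = false) ?orbF //; apply/imsetP => -[].
  by rewrite (mem_imset _ _ inr_inj) [X in X || _](_ : _ = false) //; apply/imsetP => -[].
have -> : #|C| = (3 * #|V'|)%N.
  have -> : C = setX V' [set: 'I_3] by apply/setP => -[w k]; rewrite !inE andbT.
  by rewrite cardsX cardsT card_ord mulnC.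
lia.
Qed.

(** * Symmetry of the rigidity matrix under the inversion *)

Section Inversion.
Variables (theta : V -> V) (p : V -> 'rV[R]_3).
Hypothesis theta_aut : forall u v, e (theta u) (theta v) = e u v.
Hypothesis theta_inv : involutive theta.
Hypothesis e_sym : symmetric e.
Hypothesis p_inv : forall v, p (theta v) = - p v.

Let theta_inj : injective theta := inv_inj theta_inv.

(** The image pair is put in the order chosen for edges; the default of [insubd] is never taken, as
    [val_edge_image] shows. *)
Definition edge_image f : edge_of e :=
  let u := theta (val f).1 in let v := theta (val f).2 in
  insubd f (if (enum_rank u < enum_rank v)%N then (u, v) else (v, u)).

Lemma val_edge_image f : val (edge_image f) =
  let u := theta (val f).1 in let v := theta (val f).2 in
  if (enum_rank u < enum_rank v)%N then (u, v) else (v, u).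
Proof.
rewrite insubdK // unfold_in /edge_pred; have /andP[ef _] := valP f.
case: ltnP => /= [->|]; first by rewrite theta_aut ef.
rewrite e_sym theta_aut ef leq_eqVlt => /predU1P[/val_inj/enum_rank_inj/theta_inj/eqP|//].
by rewrite eq_sym (negPf (edge_neq f)).
Qed.

Lemma edge_image_inj : injective edge_image.
Proof.
move=> f f' /(congr1 val); rewrite !val_edge_image /=.
have /andP[_ ff] := valP f; have /andP[_ ff'] := valP f'.
case: ifP => _; case: ifP => _ [/theta_inj h1 /theta_inj h2]; apply: val_inj;
  rewrite [LHS]surjective_pairing [RHS]surjective_pairing ?h1 ?h2 //.
- by move: ff; rewrite h1 h2 ltnNge ltnW.
- by move: ff; rewrite h1 h2 ltnNge ltnW.
Qed.

Definition row_image r : (edge_of e + V)%type :=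
  match r with inl f => inl (edge_image f) | inr v => inr (theta v) end.
Definition col_image (c : (V * 'I_3)%type) := (theta c.1, c.2).

Lemma row_image_inj : injective row_image.
Proof. by move=> [f|v] [f'|v'] //= [] => [/edge_image_inj->|/theta_inj->]. Qed.

Lemma col_imageK : involutive col_image.
Proof. by move=> [v k]; rewrite /col_image /= theta_inv. Qed.

Lemma rig_entry_image r c : rig_entry p (row_image r) (col_image c) = - rig_entry p r c.
Proof.
case: r c => [f|v] [w k]; rewrite /rig_entry /row_image /col_image.
  have ab := edge_neq f; rewrite val_edge_image.
  set a := (val f).1 in ab *; set b := (val f).2 in ab *.
  rewrite /=; case: ltnP => _ /=; rewrite !(inj_eq theta_inj) !p_inv !mxE.
    by case: eqP => _; [|case: eqP => _]; ring.
  have [->|wa] := eqVneq w a; first by rewrite (negPf ab); ring.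
  by case: eqP => _; ring.
rewrite /= (inj_eq theta_inj) p_inv !mxE; case: eqP => _; last by rewrite oppr0.
by case: k => [[|[|[|k]]] //= kk]; ring.
Qed.

(* The trace of the permutation induced on the rows equals the one on the
   columns minus the one on the kernel, up to sign; both of these vanish. *)
Lemma isostatic_no_fixed_edge : (forall v, on_cylinder (p v)) -> (forall v, theta v != v) ->
  (0 < #|V|)%N -> row_free (rigidity_matrix e p) -> kernel_trivial p ->
  forall f, edge_image f != f.
Proof.
move=> pY theta_free V0 /row_freeP[N MN] ker.
set M := rigidity_matrix e p in MN.
have ME r c : M (enum_rank r) (enum_rank c) = rig_entry p r c by rewrite !mxE !enum_rankK.
pose T := trivial_motions p.
have TE l c : T l (enum_rank (col_image c)) = (if l == 0 then 1 else -1) * T l (enum_rank c).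
  rewrite !mxE !enum_rankK /=; case: (l == 0); rewrite ?mul1r //.
  by rewrite /col_image /= !p_inv; case: c => v [[|[|[|k]]] //= kk]; rewrite !mxE /=; ring.
(* The projection onto the kernel of [M] along the image of its right inverse [N]. *)
pose K := 1%:M - N *m M.
have /submxP[D KD] : (K^T <= T)%MS.
  apply: submx_trans (ker_trivial ker); apply/sub_kermxP.
  by rewrite -trmx_mul /K mulmxBr mulmx1 mulmxA MN mul1mx subrr trmx0.
have DT : T *m D = 1%:M.
  have Tfree : row_free T.
    have /card_gt0P[v _] := V0.
    have := @trivial_free p _ id v (pY v) (fun k => ex_intro _ (enum_rank (v, k)) erefl).
    by rewrite (_ : colsub id _ = T) //; apply/matrixP => i j; rewrite mxE.
  apply: (row_free_inj Tfree); rewrite mul1mx -mulmxA -KD.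
  apply: trmx_inj; rewrite trmx_mul trmxK /K mulmxBl mul1mx -mulmxA.
  by rewrite rigidity_trivial mulmx0 subr0.
have KE c c' : K (enum_rank c) (enum_rank c') = \sum_l T l (enum_rank c) * D (enum_rank c') l.
  transitivity (K^T (enum_rank c') (enum_rank c)); first by rewrite [RHS]mxE.
  by rewrite KD mxE; apply: eq_bigr => l _; rewrite mulrC.
have trK : \sum_c K (enum_rank c) (enum_rank (col_image c)) = 0.
  transitivity (\sum_(l < 2) (if l == 0 then 1 else -1) * (T *m D) l l : R); last first.
    by rewrite DT !big_ord_recl big_ord0 !mxE /=; ring.
  under eq_bigr do rewrite KE.
  rewrite exchange_big; apply: eq_bigr => l _ /=.
  rewrite mxE mulr_sumr (reindex_inj (inv_inj col_imageK)) /= -[LHS]sum_enum_val.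
  by apply: eq_bigr => j _; rewrite TE col_imageK enum_valK mulrA.
(* Moving [M] around the trace turns the count of fixed rows into minus a twisted trace of [N *m M],
   that is of [1%:M - K]; no column is fixed, and [trK] disposes of [K]. *)
have : \sum_r (row_image r == r)%:R = 0 :> R.
  transitivity (\sum_r (M *m N) (enum_rank r) (enum_rank (row_image r))).
    by apply: eq_bigr => r _; rewrite MN mxE (inj_eq enum_rank_inj) eq_sym.
  transitivity (- \sum_r \sum_c rig_entry p r (col_image c) * N (enum_rank c) (enum_rank r)).
    rewrite [X in - X](reindex_inj row_image_inj) -sumrN; apply: eq_bigr => r _ /=.
    rewrite mul_rigidity -sumrN; apply: eq_bigr => c _.
    by rewrite rig_entry_image; ring.
  rewrite exchange_big -sumrN -[RHS]trK; apply: eq_bigr => c _ /=.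
  rewrite [RHS]mxE [X in _ = X + _]mxE [X in _ = _ + X]mxE (inj_eq enum_rank_inj).
  have -> : (c == col_image c) = false.
    by apply/negbTE; apply: contra (theta_free c.1) => /eqP {2}->.
  rewrite add0r; congr (- _); rewrite mxE -[LHS]sum_enum_val; apply: eq_bigr => j _.
  by rewrite -ME enum_valK mulrC.
move/eqP; rewrite psumr_eq0 => [/allP h f|r _]; last exact: ler0n.
have := h (inl f) (mem_index_enum _); rewrite /= pnatr_eq0 eqb0.
by apply: contra => /eqP ->.
Qed.

End Inversion.

End RigidityMatrix.

(** * The quotient by the involution *)

Section Quotient.
Variables (V : finType) (e : rel V) (theta : V -> V).
Hypothesis e_sym : symmetric e.
Hypothesis e_irr : irreflexive e.
Hypothesis theta_aut : forall u v, e (theta u) (theta v) = e u v.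
Hypothesis theta_inv : involutive theta.
Hypothesis theta_free : forall v, theta v != v.
Hypothesis edge_free : forall v, ~~ e v (theta v).
Local Open Scope nat_scope.

Let theta_inj : injective theta := inv_inj theta_inv.

(** The orbit set is encoded inside [V] itself, by the vertex of smaller rank in each orbit. *)
Definition reps : {set V} := [set v | enum_rank v < enum_rank (theta v)].
Definition vertex_of (y : V * bool) := if y.2 then theta y.1 else y.1.
Definition fiber v : V * bool := if v \in reps then (v, false) else (theta v, true).

Lemma theta_reps v : (theta v \in reps) = (v \notin reps).
Proof.
rewrite !inE theta_inv -leqNgt ltn_neqAle andb_idl // => _.
by apply: contra (theta_free v) => /eqP/val_inj/enum_rank_inj->.
Qed.

Lemma fiber_reps v : (fiber v).1 \in reps.
Proof. by rewrite /fiber; case: ifP => // /negbT; rewrite -theta_reps. Qed.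

Lemma fiberK v : vertex_of (fiber v) = v.
Proof. by rewrite /fiber /vertex_of; case: (v \in reps) => //=; apply: theta_inv. Qed.

Lemma vertex_ofK y : y.1 \in reps -> fiber (vertex_of y) = y.
Proof.
case: y => i [] iS; rewrite /vertex_of /fiber /= ?theta_reps; last by rewrite iS.
by rewrite iS theta_inv.
Qed.

Lemma fiber_theta v : fiber (theta v) = ((fiber v).1, ~~ (fiber v).2).
Proof. by rewrite /fiber theta_reps theta_inv; case: (v \in reps). Qed.

Definition sheets : {set V * bool} := [set y | y.1 \in reps].

Lemma in_sheets y : (y \in sheets) = (y.1 \in reps).
Proof. by rewrite in_set. Qed.

Lemma vertex_of_inj : {in sheets &, injective vertex_of}.
Proof. by move=> y y'; rewrite !in_sheets => yS y'S /(congr1 fiber); rewrite !vertex_ofK. Qed.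

Lemma card_reps : 2 * #|reps| = #|V|.
Proof.
have -> : #|V| = #|vertex_of @: sheets|.
  rewrite -cardsT; congr #|pred_of_set _|; apply/esym/setP => v; rewrite inE.
  by apply/imsetP; exists (fiber v); rewrite ?in_sheets ?fiber_reps ?fiberK.
rewrite (card_in_imset vertex_of_inj) (_ : sheets = setX reps [set: bool]).
  by rewrite cardsX cardsT card_bool mulnC.
by apply/setP => -[i b]; rewrite in_setX in_sheets in_setT andbT.
Qed.

(** Ordering the representatives keeps one orientation of each edge orbit. *)
Definition quotient_edge : pred (V * V * bool) := fun t =>
  [&& t.1.1 \in reps, t.1.2 \in reps, enum_rank t.1.1 < enum_rank t.1.2 &
      e t.1.1 (vertex_of (t.1.2, t.2))].

Definition quotient_graph : seq (gedge V) := [seq (0, t) | t <- enum quotient_edge].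

Lemma mem_quotient i j g : ((0, (i, j, g)) \in quotient_graph) = quotient_edge (i, j, g).
Proof.
by rewrite mem_map ?mem_enum // => t t' [].
Qed.

Lemma quotientP (f : gedge V) : f \in quotient_graph ->
  [/\ tag f = 0, src f \in reps, tgt f \in reps, enum_rank (src f) < enum_rank (tgt f) &
   e (src f) (vertex_of (tgt f, gain f))].
Proof. by case/mapP => t; rewrite mem_enum => /and4P[? ? ? ?] ->. Qed.

Lemma sum_symmetric (G : V -> V -> nat) : (forall i j, G i j = G j i) -> (forall i, G i i = 0) ->
  \sum_i \sum_j G i j = 2 * \sum_i \sum_(j | enum_rank i < enum_rank j) G i j.
Proof.
move=> Gs G0; rewrite mul2n -addnn.
rewrite [X in _ = _ + X](exchange_big_dep xpredT) //= -big_split /=; apply: eq_bigr => i _.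
rewrite (bigID (fun j => enum_rank i < enum_rank j)) /=; congr (_ + _).
rewrite [RHS]big_mkcond [LHS]big_mkcond; apply: eq_bigr => j _.
rewrite -leqNgt leq_eqVlt; case: eqP => [/val_inj/enum_rank_inj->|_] /=.
  by rewrite ltnn G0.
by rewrite Gs.
Qed.

(** Ordered pairs need no choice of orientation, which makes edges of [e] comparable with lifts of
    quotient edges. *)
Definition arcs (W : {set V}) := \sum_u \sum_v (u \in W) * (v \in W) * e u v.

Lemma arcs_edges (W : {set V}) :
  arcs W = 2 * #|[set f : edge_of e | ((val f).1 \in W) && ((val f).2 \in W)]|.
Proof.
rewrite /arcs sum_symmetric => [|u v|u]; last by rewrite e_irr muln0.
  congr (2 * _); rewrite -(card_imset _ val_inj) -[RHS]sum1_card.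
  under eq_bigr do rewrite big_mkcond.
  rewrite pair_bigA /= [RHS]big_mkcond; apply: eq_bigr => -[u v] _ /=.
  have -> : ((u, v) \in [set val x | x in [set f : edge_of e |
      ((val f).1 \in W) && ((val f).2 \in W)]]) =
      [&& enum_rank u < enum_rank v, e u v, u \in W & v \in W].
    apply/imsetP/and4P => [[f fW uvf]|[uv euv uW vW]].
      move: fW; rewrite inE -uvf => /andP[-> ->].
      by have := valP f; rewrite -uvf => /andP[/= -> ->].
    have uvP : edge_pred e (u, v) by rewrite /edge_pred /= euv uv.
    by exists (Sub (u, v) uvP); rewrite ?inE SubK ?uW.
  by case: (_ < _); case: (e u v); case: (u \in W); case: (v \in W).
by rewrite e_sym mulnC (mulnC (_ \in _)) mulnC.
Qed.

(** Two representatives have four pairs of lifts, on which [theta] identifies adjacencies two by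
    two; these are the two lifts for each gain. *)
Lemma arcs_quotient (X : {set V * bool}) : X \subset sheets ->
  arcs (vertex_of @: X) = 2 * cnt quotient_graph X.
Proof.
move=> /subsetP XS.
have sum_lift (h : V -> nat) : \sum_u (u \in vertex_of @: X) * h u =
    \sum_i \sum_(b : bool) ((i, b) \in X) * h (vertex_of (i, b)).
  transitivity (\sum_(u in vertex_of @: X) h u).
    by rewrite [RHS]big_mkcond; apply: eq_bigr => u _; case: (_ \in _); rewrite ?mul1n ?mul0n.
  rewrite big_imset /=; last by move=> y y' /XS yS /XS y'S; apply: vertex_of_inj.
  rewrite pair_bigA [LHS]big_mkcond; apply: eq_bigr => -[i b] _ /=.
  by case: (_ \in _); rewrite ?mul1n ?mul0n.
pose G i j := \sum_(b : bool) \sum_(c : bool)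
  ((i, b) \in X) * ((j, c) \in X) * e (vertex_of (i, b)) (vertex_of (j, c)).
transitivity (\sum_i \sum_j G i j).
  transitivity (\sum_u (u \in vertex_of @: X) * \sum_v (v \in vertex_of @: X) * e u v).
    by apply: eq_bigr => u _; rewrite big_distrr /=; apply: eq_bigr => v _; rewrite mulnA.
  rewrite sum_lift; apply: eq_bigr => i _.
  rewrite /G exchange_big /=; apply: eq_bigr => b _.
  rewrite sum_lift big_distrr /=; apply: eq_bigr => j _; rewrite big_distrr /=.
  by apply: eq_bigr => c _; rewrite mulnA.
rewrite sum_symmetric => [|i j|i].
- congr (2 * _); rewrite /cnt big_map big_enum /=.
  transitivity (\sum_i \sum_j \sum_g if quotient_edge (i, j, g) then cnt1 (0, (i, j, g)) X else 0).
    apply: eq_bigr => i _; rewrite big_mkcond; apply: eq_bigr => j _.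
    rewrite /quotient_edge /=; case: (_ < _) => /=; last first.
      by rewrite big_bool !andbF.
    have notX v b : v \notin reps -> ((v, b) \in X) = false.
      by move=> vS; apply: contraNF vS => /XS; rewrite in_sheets.
    rewrite /G !big_bool /cnt1 /src /tgt /gain /vertex_of /=.
    have [iS|/notX niX] := boolP (i \in reps); last by rewrite !niX.
    have [jS|/notX njX] := boolP (j \in reps); last by rewrite !njX !muln0.
    rewrite /= theta_aut -(theta_aut (theta i) j) theta_inv.
    by case: (e i j); case: (e i (theta j)); do 4 case: (_ \in X).
  by rewrite pair_bigA pair_bigA /= [RHS]big_mkcond; apply: eq_bigr => -[[i j] g].
- rewrite /G exchange_big; apply: eq_bigr => b _; apply: eq_bigr => c _.
  by rewrite e_sym (mulnC (_ \in _)).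
have ne (u v : V) : u = v \/ u = theta v -> e u v = false.
  by case=> ->; [apply: e_irr | rewrite e_sym; apply/negbTE].
rewrite /G !big_bool /vertex_of /= !ne ?muln0 //; auto.
Qed.

Lemma wf_quotient : tight22 e -> wf reps quotient_graph.
Proof.
move=> [szE spE].
have edgesW (X : {set V * bool}) : X \subset sheets ->
    cnt quotient_graph X =
    #|[set f : edge_of e | ((val f).1 \in vertex_of @: X) && ((val f).2 \in vertex_of @: X)]|.
  move=> XS; have := arcs_edges (vertex_of @: X); rewrite arcs_quotient // => /eqP.
  by rewrite eqn_pmul2l // => /eqP.
split.
- by rewrite map_inj_uniq ?enum_uniq // => t t' [].
- by move=> f /quotientP[_ -> ->].
- move=> f /quotientP[_ _ _ lt _] _; apply/andP; split.
    by apply: contraTN lt => /eqP->; rewrite ltnn.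
  by rewrite mem_quotient; apply/negP => /and4P[_ _ /=]; rewrite ltnNge ltnW.
(* Cover elements outside the sheets meet no edge, so the bound reduces to the part inside. *)
- move=> X X0; pose X' := X :&: sheets.
  have -> : cnt quotient_graph X = cnt quotient_graph X'.
    rewrite /cnt big_seq [RHS]big_seq; apply: eq_bigr => f /quotientP[_ sf tf _ _].
    by rewrite /cnt1 !in_setI !in_sheets /= sf tf !andbT.
  have X'S : X' \subset sheets by apply: subsetIr.
  have cX' : #|X'| <= #|X| by apply: subset_leq_card; apply: subsetIl.
  have [X'0|X'0] := eqVneq X' set0.
    rewrite X'0 /cnt big1 => [|f _]; last by rewrite /cnt1 !inE.
    by move: X0; rewrite -card_gt0; lia.
  rewrite edgesW //; set E' := finset _.
  have := spE (vertex_of @: X') E'; rewrite card_in_imset; last first.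
    by move=> y y' /(subsetP X'S) yS /(subsetP X'S); apply: vertex_of_inj.
  have W0 : vertex_of @: X' != set0 by rewrite imset_eq0.
  by move=> /(_ W0) h; have : #|E'| + 2 <= 2 * #|X'|; [apply: h => f; rewrite inE | lia].
(* Every edge lies over the full set of sheets, so twice the size of the quotient is the number of
   edges. *)
have := edgesW _ (subxx sheets); rewrite /cnt (@sum_const_on _ _ _ 2); last first.
  by move=> f /quotientP[_ sf tf _ _]; rewrite /cnt1 !in_sheets /= sf tf.
have liftT v : v \in vertex_of @: sheets.
  by apply/imsetP; exists (fiber v); rewrite ?in_sheets ?fiber_reps ?fiberK.
have -> : #|[set f : edge_of e | ((val f).1 \in vertex_of @: sheets) && ((val f).2 \in vertex_of @: sheets)]| =
    #|{: edge_of e}|.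
  by rewrite -cardsT; apply: eq_card => f; rewrite !inE !liftT.
have := card_reps; lia.
Qed.

(** * Realization of the quotient on the cylinder *)

Section Realization.
Local Open Scope ring_scope.
Variables (R : realFieldType) (q : V -> R * R) (c : gedge V -> R * R).

Definition realization v : 'rV[R]_3 := vec3 (ptx q (fiber v)) (pty q (fiber v)) (hgt q (fiber v)).
Let p := realization.

Lemma realization_inv v : p (theta v) = - p v.
Proof.
apply/rowP => k; rewrite /p /realization fiber_theta /ptx /pty /hgt /sg /=.
case: k => [[|[|[|k]]] //= kk]; rewrite !mxE /=; case: (fiber v).2 => /=; ring.
Qed.

Lemma realization_on_Y v : on_cylinder (p v).
Proof.
by rewrite /on_cylinder /p /realization; have [-> -> _] := vec3E (ptx q (fiber v)) (pty q (fiber v)) (hgt q (fiber v)); apply: pt_unit.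
Qed.

Lemma realization_inj : generic q -> injective p.
Proof.
move=> gq u v uv; rewrite -(fiberK u) -(fiberK v); congr vertex_of; apply: gq.
have := congr1 (fun r : 'rV_3 => (r 0 0, r 0 1)) uv.
by rewrite !mxE.
Qed.

(** A velocity field of the right parity is determined on the representatives, where its edge
    equations are those of the gain graph. *)
Lemma realization_ker (eps : bool) (w om : V -> R) :
  rigid eps q c reps quotient_graph ->
  (forall u v, e u v -> (p u 0 2%:R - p v 0 2%:R) * (w u - w v) +
    (p u 0 1 * p v 0 0 - p u 0 0 * p v 0 1) * (om u - om v) = 0) ->
  (forall v, w (theta v) = (if eps then -1 else 1) * w v) ->
  (forall v, om (theta v) = (if eps then 1 else -1) * om v) ->
  exists A B, forall v, w v = A /\ om v = B.
Proof.
move=> rig eqs ws oms.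
have liftE i b : w (vertex_of (i, b)) = liftw eps w (i, b) /\ om (vertex_of (i, b)) = lifto eps om (i, b).
  rewrite /vertex_of /liftw /lifto /sw /so /sg /=.
  by case: (eps) ws oms => ws oms; case: (b); rewrite /= ?ws ?oms ?mul1r.
have pE y : y.1 \in reps -> [/\ p (vertex_of y) 0 0 = ptx q y, p (vertex_of y) 0 1 = pty q y &
    p (vertex_of y) 0 2%:R = hgt q y].
  by move=> yS; rewrite /p /realization vertex_ofK //; apply: vec3E.
have [A [B cAB]] : exists A B, const_on eps reps w om A B.
  apply: rig => f /quotientP[t0 sS tS _ st].
  have [p1 p2 p3] : [/\ p (src f) 0 0 = ptx q (src f, false), p (src f) 0 1 = pty q (src f, false)
    & p (src f) 0 2%:R = hgt q (src f, false)] := pE (src f, false) sS.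
  have [r1 r2 r3] := pE (tgt f, gain f) tS.
  have := eqs _ _ st; rewrite p1 p2 p3 r1 r2 r3; have [-> ->] := liftE (tgt f) (gain f).
  by rewrite /eqn /eqrow /coef t0.
exists A, B => v; rewrite -(fiberK v) [fiber v]surjective_pairing.
by have [-> ->] := liftE (fiber v).1 (fiber v).2; apply: cAB; apply: fiber_reps.
Qed.

Lemma realization_kernel_trivial :
  rigid true q c reps quotient_graph -> rigid false q c reps quotient_graph ->
  kernel_trivial e p.
Proof.
move=> rigt rigf u Mu; pose U v k := u (enum_rank (v, k)) 0.
(* Axial and angular components; the vertex rows make the radial one vanish. *)
pose w v := U v 2%:R; pose om v := p v 0 0 * U v 1 - p v 0 1 * U v 0.
have rowE (r : (edge_of e + V)%type) : \sum_c rig_entry p r c * u (enum_rank c) 0 = 0.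
  by rewrite -mul_rigidity Mu mxE.
have tan v : p v 0 0 * U v 0 + p v 0 1 * U v 1 = 0.
  by have := rowE (inr v); rewrite sum_rig_entry.
have U0 v : U v 0 = - p v 0 1 * om v.
  have h := realization_on_Y v.
  transitivity ((p v 0 0 ^+ 2 + p v 0 1 ^+ 2) * U v 0); first by rewrite h mul1r.
  transitivity (p v 0 0 * (p v 0 0 * U v 0 + p v 0 1 * U v 1) - p v 0 1 * om v).
    by rewrite /om; ring.
  by rewrite tan; ring.
have U1 v : U v 1 = p v 0 0 * om v.
  have h := realization_on_Y v.
  transitivity ((p v 0 0 ^+ 2 + p v 0 1 ^+ 2) * U v 1); first by rewrite h mul1r.
  transitivity (p v 0 1 * (p v 0 0 * U v 0 + p v 0 1 * U v 1) + p v 0 0 * om v).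
    by rewrite /om; ring.
  by rewrite tan; ring.
have eqs a b : e a b -> (p a 0 2%:R - p b 0 2%:R) * (w a - w b) +
    (p a 0 1 * p b 0 0 - p a 0 0 * p b 0 1) * (om a - om b) = 0.
  have half a' b' : e a' b' -> (enum_rank a' < enum_rank b')%N ->
    (p a' 0 2%:R - p b' 0 2%:R) * (w a' - w b') +
    (p a' 0 1 * p b' 0 0 - p a' 0 0 * p b' 0 1) * (om a' - om b') = 0.
    move=> ab lt; have fP : edge_pred e (a', b') by rewrite /edge_pred /= ab lt.
    rewrite -[RHS](rowE (inl (Sub (a', b') fP))) sum_rig_entry SubK /= sum3.
    rewrite -/(U a' 0) -/(U a' 1) -/(U b' 0) -/(U b' 1) !U0 !U1.
    have sub k : (p a' - p b') 0 k = p a' 0 k - p b' 0 k by rewrite mxE [X in _ + X]mxE.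
    by rewrite !sub /w /U; ring.
  move=> ab; have [lt|gt|/val_inj/enum_rank_inj abE] := ltngtP (enum_rank a) (enum_rank b).
  - exact: half.
  - by rewrite -[RHS](half b a) 1?e_sym //; ring.
  - by rewrite abE e_irr in ab.
(* The equation of the image edge: the height difference changes sign, the determinant does not. *)
have eqs' a b : e a b -> (p a 0 2%:R - p b 0 2%:R) * (w (theta a) - w (theta b)) -
    (p a 0 1 * p b 0 0 - p a 0 0 * p b 0 1) * (om (theta a) - om (theta b)) = 0.
  have opp v k : p (theta v) 0 k = - p v 0 k by rewrite realization_inv mxE.
  rewrite -theta_aut => /eqs; rewrite !opp => h.
  by apply: oppr_inj; rewrite oppr0 -[RHS]h; ring.
(* Twice the invariant part of the motion; the anti-invariant part follows. *)
have [|||A [B AB]] := @realization_ker true (fun v => w v - w (theta v)) (fun v => om v + om (theta v)) rigt.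
- by move=> a b ab; rewrite -[RHS](subrr 0) -[X in _ = X - _](eqs a b ab) -(eqs' a b ab); ring.
- by move=> v; rewrite theta_inv; ring.
- by move=> v; rewrite theta_inv; ring.
have [|||A' [B' AB']] := @realization_ker false (fun v => w v + w (theta v)) (fun v => om v - om (theta v)) rigf.
- by move=> a b ab; rewrite -[RHS]addr0 -[X in _ = X + _](eqs a b ab) -(eqs' a b ab); ring.
- by move=> v; rewrite theta_inv; ring.
- by move=> v; rewrite theta_inv; ring.
(* A constant odd function is 0, so only the even sum contributes. *)
have wE v : w v = A' / 2.
  by have [h1 _] := AB v; have [h2 _] := AB (theta v); have [h3 _] := AB' v;
    rewrite theta_inv in h2; lra.
have omE v : om v = B / 2.
  by have [_ h1] := AB v; have [_ h2] := AB' (theta v); have [_ h3] := AB' v;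
    rewrite theta_inv in h2; lra.
exists (A' / 2), (B / 2) => v k; rewrite -/(U v k).
have [e0 e1 e2] := vec3E (- (B / 2) * p v 0 1) (B / 2 * p v 0 0) (A' / 2).
have [||] : [\/ k = 0, k = 1 | k = 2%:R].
  by case: k => [[|[|[|k]]] //= kk]; [apply: Or31 | apply: Or32 | apply: Or33]; apply: val_inj.
- by move->; rewrite e0 U0 omE; ring.
- by move->; rewrite e1 U1 omE; ring.
- by move->; rewrite e2 -(wE v).
Qed.

End Realization.

End Quotient.

(** * The two implications *)

Section Main.
Variables (R : realFieldType) (V : finType) (e : rel V) (theta : V -> V).
Hypothesis e_sym : symmetric e.
Hypothesis e_irr : irreflexive e.
Hypothesis V_nonempty : (0 < #|V|)%N.
Hypothesis theta_aut : forall u v, e (theta u) (theta v) = e u v.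
Hypothesis theta_inv : involutive theta.

Lemma isostatic_necessary (p : V -> 'rV[R]_3) : (forall v, on_cylinder (p v)) ->
  (forall v, p (theta v) = - p v) -> isostatic e p ->
  tight22 e /\ ~ fixes_vertex theta /\ ~ fixes_edge e theta.
Proof.
move=> pY p_inv [free ker].
(* A fixed vertex would lie at the origin, off the cylinder. *)
have theta_free v : theta v != v.
  apply/eqP => tv; have := p_inv v; rewrite tv => pv0.
  have coord k : p v 0 k = 0.
    by have := congr1 (fun r : 'rV_3 => r 0 k) pv0; rewrite /= [RHS]mxE; lra.
  by have := pY v; rewrite /on_cylinder !coord expr0n addr0 => /eqP; rewrite eq_sym oner_eq0.
have sparse22 := @row_free_sparse R V e p _ _ pY free.
split; last split.
- split=> [|V' E' V'0 E'V']; last exact: sparse22.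
  have /card_gt0P[v _] := V_nonempty.
  have le := @sparse22 [set: V] [set: edge_of e].
  (* The rank bounds the number of edges from below, sparsity of the whole graph from above. *)
  have rk := rank_ge ker; rewrite (eqP free) card_rows in rk.
  have {}le : (#|{: edge_of e}| + 2 <= 2 * #|V|)%N.
    rewrite -[#|{: edge_of e}|]cardsT -[#|V|]cardsT.
    by apply: le => [|f _]; [apply/set0Pn; exists v; rewrite inE | rewrite !inE].
  lia.
- by move=> [v tv]; have := theta_free v; rewrite tv eqxx.
move=> [u [v [uv [[tu _]|[tu tv]]]]]; first by have := theta_free u; rewrite tu eqxx.
have nofix := isostatic_no_fixed_edge theta_aut theta_inv e_sym p_inv pY theta_free V_nonempty free ker.
have half a b : e a b -> theta a = b -> theta b = a -> (enum_rank a < enum_rank b)%N -> False.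
  move=> ab ta tb lt; have fP : edge_pred e (a, b) by rewrite /edge_pred /= ab lt.
  have /eqP[] := nofix (Sub (a, b) fP); apply: val_inj; rewrite val_edge_image // SubK /= ta tb.
  by rewrite ltnNge ltnW.
have [lt|gt|/val_inj/enum_rank_inj uvE] := ltngtP (enum_rank u) (enum_rank v).
- exact: half uv tu tv lt.
- by apply: half gt => //; rewrite e_sym.
- by rewrite uvE e_irr in uv.
Qed.

Lemma isostatic_sufficient :
  tight22 e -> ~ fixes_vertex theta -> ~ fixes_edge e theta ->
  exists p : V -> 'rV[R]_3, framework_on_Y e p /\ (forall v, p (theta v) = - p v) /\ isostatic e p.
Proof.
move=> tight nv ne.
have theta_free v : theta v != v by apply/eqP => tv; apply: nv; exists v.
have edge_free v : ~~ e v (theta v).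
  by apply/negP => ev; apply: ne; exists v, (theta v); split=> //; right.
pose L := quotient_graph e theta; pose S := reps theta.
have wfL : wf S L := wf_quotient e_sym e_irr theta_aut theta_inv theta_free edge_free tight.
have /card_gt0P[v0 _] := V_nonempty.
have rS : (fiber theta v0).1 \in S := fiber_reps theta_inv theta_free v0.
have LS : forall f, f \in L -> (src f \in S) && (tgt f \in S) by case: wfL.
(* All edges of the quotient have tag 0, so one coefficient function serves both systems. *)
pose c0 (f : gedge V) : R * R := 0.
have rig0 eps : exists q, rigid eps q c0 S L.
  have [q [c rig]] := gain_rigid R eps wfL; exists q => w om fl; apply: rig => f fL.
  by have := fl f fL; have [t0 _ _ _ _] := quotientP fL; rewrite /coef t0.
have [qt rigt] := rig0 true; have [qf rigf] := rig0 false.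
(* On the line from [qt] to [qf] one system is rigid at 0 and the other at 1, so some point serves
   both. *)
have ct := @rigid_cofin R V true c0 S L qt qf 0 _ rS LS.
have cf := @rigid_cofin R V false c0 S L qt qf 1 _ rS LS.
rewrite line0 in ct; rewrite line1 in cf.
have [s [rt rf]] := cofin_ex (cofin_and (ct rigt) (cf rigf)).
set q := line qt qf s in rt rf.
(* A second line, towards [rank_config], makes the projections distinct while keeping both systems
   rigid. *)
have ct' := @rigid_cofin R V true c0 S L q (@rank_config R V) 0 _ rS LS.
have cf' := @rigid_cofin R V false c0 S L q (@rank_config R V) 0 _ rS LS.
rewrite line0 in ct' cf'.
have [s' [gq [rt' rf']]] := cofin_ex (cofin_and (generic_cofin q) (cofin_and (ct' rt) (cf' rf))).
set q' := line q _ s' in gq rt' rf'.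
pose p := realization theta q'.
have ker : kernel_trivial e p.
  exact: realization_kernel_trivial rt' rf'.
exists p; split; last split.
- split=> [v|u v uv]; first exact: realization_on_Y.
  by apply: contraTneq uv => /(realization_inj theta_inv gq)->; rewrite e_irr.
- exact: realization_inv.
(* The rank is at least [3 * #|V| - 2], by tightness the number of rows. *)
- split=> //; have rk := rank_ge ker; have [szE _] := tight.
  rewrite /row_free eqn_leq rank_leq_row /= [X in (X <= _)%N]card_rows -(leq_add2r 2).
  by apply: leq_trans rk; rewrite addnAC szE; lia.
Qed.

End Main.

Theorem theorem5p11 (R : realType) (V : finType) (e : rel V)
  (e_sym : symmetric e) (e_irr : irreflexive e) (V_nonempty : (0 < #|V|)%N)
  (theta : V -> V)
  (theta_aut : forall u v, e (theta u) (theta v) = e u v)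
  (theta_inv : forall v, theta (theta v) = v) :
  Ci_isostatic R e theta <->
  (tight22 e /\ ~ fixes_vertex theta /\ ~ fixes_edge e theta).
Proof.
split=> [[p [[pY _] [p_inv iso]]]|[tight [nv ne]]].
  exact: isostatic_necessary p_inv iso.
exact: isostatic_sufficient.
Qed.
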